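(* Let $\lambda$ be a partition with at most $n$ parts and $\lambda_1>0$, and let $\lambda'$ denote its conjugate partition and $\ell(\lambda)$ its number of nonzero parts. For every subset $S\subseteq\{1,\dots,n\}$ with $\#S=\ell(\lambda)$, $$\sum_{\substack{\mu\in S_n(\lambda)\\ \mathrm{Supp}(\mu)=S}}f^*_\mu(x_1,\dots,x_n;1,t)=\prod_{i\in S}\left(x_i-\frac{t^{\#(S^c\cap\{1,\dots,i-1\})}}{t^{n-1}}\right)\prod_{2\le i\le\lambda_1}e^*_{\lambda'_i}(x_1,\dots,x_n;t).$$ Consequently, for every partition $\lambda$ with at most $n$ parts, $$P^*_\lambda(x_1,\dots,x_n;1,t)=\prod_{1\le i\le\lambda_1}P^*_{(1^{\lambda'_i},0^{n-\lambda'_i})}(x_1,\dots,x_n;1,t)=\prod_{1\le i\le\lambda_1}e^*_{\lambda'_i}(x_1,\dots,x_n;t).$$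
   Context: Polynomials are in $x_1,\dots,x_n$ over $\mathbb{Q}(q,t)$; $f(x;1,t)$ denotes specialization at $q=1$. For $\mu\in\mathbb{N}^n$ let $k_i(\mu)=\#\{j<i:\mu_j>\mu_i\}+\#\{j>i:\mu_j\ge\mu_i\}$ and $\widetilde\mu=(q^{\mu_1}t^{-k_1(\mu)},\dots,q^{\mu_n}t^{-k_n(\mu)})$. For $\mu\in\mathbb{N}^n$, $|\mu|=d$, $E^*_\mu$ is the unique polynomial of degree at most $d$ with coefficient of $x^\mu$ equal to $1$ and $E^*_\mu(\widetilde\nu)=0$ for all $\nu\in\mathbb{N}^n$, $|\nu|\le d$, $\nu\ne\mu$. $S_n$ acts on compositions by $\sigma\cdot\mu=(\mu_{\sigma^{-1}(1)},\dots,\mu_{\sigma^{-1}(n)})$ and on polynomials by permuting variables; $s_i=(i,i+1)$; $T_i=t-\frac{tx_i-x_{i+1}}{x_i-x_{i+1}}(1-s_i)$; $T_\sigma=T_{i_1}\cdots T_{i_\ell}$ for a reduced word. $S_n(\lambda)$ is the set of rearrangements of $\lambda$; for $\mu\in S_n(\lambda)$, $\sigma_\mu$ is the shortest permutation with $\sigma_\mu(\lambda)=\mu$ and $f^*_\mu=T_{\sigma_\mu}E^*_\lambda$. $P^*_\lambda$ is the unique symmetric polynomial of degree at most $|\lambda|$ with coefficient $1$ on the monomial symmetric polynomial $m_\lambda$ and vanishing at $\widetilde\nu$ for every partition $\nu\ne\lambda$ with $|\nu|\le|\lambda|$. $\mathrm{Supp}(\mu)=\{i:\mu_i>0\}$,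 $S^c$ is the complement of $S$ in $\{1,\dots,n\}$, and for $k\ge0$, $$e^*_k(x_1,\dots,x_n;t)=\sum_{S\subseteq\{1,\dots,n\},\ \#S=k}\ \prod_{i\in S}\left(x_i-\frac{t^{\#(S^c\cap\{1,\dots,i-1\})}}{t^{n-1}}\right).$$ *)

(* Defs.v *)
From HB Require Import structures.
From mathcomp Require Import all_boot all_order all_algebra all_fingroup.
From mathcomp Require Import fraction.
From mathcomp Require Export mpoly.
From Stdlib Require Import ClassicalEpsilon.

Set Implicit Arguments.
Unset Strict Implicit.
Unset Printing Implicit Defensive.

Import Order.TTheory GRing.Theory.
Local Open Scope ring_scope.

(* Q[t] = {poly rat} (variable t);  Q[t][q] = {poly {poly rat}}       *)
(* (outer variable q).  Q(q,t) = Frac(Q[t][q]),  Q(t) = Frac(Q[t]).    *)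
Definition Rqt : idomainType := {poly {poly rat}}.
Definition Kqt : fieldType := {fraction {poly {poly rat}}}.
Definition Kt : fieldType := {fraction {poly rat}}.

Definition frac_qt (a : {poly {poly rat}}) : Kqt := FracField.tofrac a.
Definition frac_t (a : {poly rat}) : Kt := FracField.tofrac a.

Definition qK : Kqt := frac_qt 'X.
Definition tK : Kqt := frac_qt ('X : {poly rat})%:P.
Definition tQ : Kt := frac_t 'X.

(* (The value g is unique when it exists.)                                *)
Definition spec1 (f : Kqt) (g : Kt) : Prop :=
  exists a b : {poly {poly rat}},
    [/\ b.[1] != 0, f = frac_qt a / frac_qt b & g = frac_t a.[1] / frac_t b.[1]].

Definition mspec1 n (f : {mpoly Kqt[n]}) (g : {mpoly Kt[n]}) : Prop :=
  forall m : 'X_{1..n}, spec1 f@_m g@_m.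

(* Compositions mu in N^n are monomials 'X_{1..n}; indices are 0-based. *)

Definition kidx n (mu : 'X_{1..n}) (i : 'I_n) : nat :=
  (#|[set j : 'I_n | (j < i)%N && (mu i < mu j)%N]|
   + #|[set j : 'I_n | (i < j)%N && (mu i <= mu j)%N]|)%N.

Definition tilde n (mu : 'X_{1..n}) : 'I_n -> Kqt :=
  fun i => qK ^+ (mu i) / tK ^+ (kidx mu i).

(* Interpolation nonsymmetric Macdonald polynomial E*_mu : the unique      *)
(* polynomial with the stated properties (chosen by epsilon).              *)
Definition IsEstar n (mu : 'X_{1..n}) (p : {mpoly Kqt[n]}) : Prop :=
  [/\ (msize p <= (mdeg mu).+1)%N, p@_mu = 1 &
      forall nu : 'X_{1..n}, (mdeg nu <= mdeg mu)%N -> nu != mu ->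
        p.@[tilde nu] = 0].

Definition Estar n (mu : 'X_{1..n}) : {mpoly Kqt[n]} :=
  epsilon (inhabits 0) (IsEstar mu).

Definition cact n (s : 'S_n) (mu : 'X_{1..n}) : 'X_{1..n} :=
  [multinom mu ((s^-1)%g j) | j < n].

Definition lo_ix n (i : 'I_n.-1) : 'I_n := widen_ord (leq_pred n) i.
Definition hi_ix n (i : 'I_n.-1) : 'I_n := insubd (lo_ix i) i.+1.
(* val (lo_ix i) = i and val (hi_ix i) = i+1 (since i + 1 < n) *)
Definition sadj n (i : 'I_n.-1) : 'S_n := tperm (lo_ix i) (hi_ix i).

(* the permutation s_{i1} o s_{i2} o ... o s_{il} (function composition) *)
Definition perm_of_word n (w : seq 'I_n.-1) : 'S_n :=
  foldr (fun i acc => (acc * sadj i)%g) 1%g w.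

(* Coxeter length = number of inversions *)
Definition plength n (s : 'S_n) : nat :=
  #|[set p : 'I_n * 'I_n | (p.1 < p.2)%N && (s p.2 < s p.1)%N]|.

Definition red_word n (s : 'S_n) : seq 'I_n.-1 :=
  if [pick w : (plength s).-tuple 'I_n.-1 | perm_of_word w == s] is Some w
  then val w else [::].

Definition spoly n (i : 'I_n.-1) (f : {mpoly Kqt[n]}) : {mpoly Kqt[n]} :=
  msym (sadj i) f.

Definition ddiff n (i : 'I_n.-1) (f : {mpoly Kqt[n]}) : {mpoly Kqt[n]} :=
  epsilon (inhabits 0)
    (fun g => ('X_(lo_ix i) - 'X_(hi_ix i)) * g = f - spoly i f).

Definition Hecke n (i : 'I_n.-1) (f : {mpoly Kqt[n]}) : {mpoly Kqt[n]} :=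
  tK *: f - (tK *: 'X_(lo_ix i) - 'X_(hi_ix i)) * ddiff i f.

Definition Tperm n (s : 'S_n) (f : {mpoly Kqt[n]}) : {mpoly Kqt[n]} :=
  foldr (fun i g => Hecke i g) f (red_word s).

Definition sigma_of n (lam mu : 'X_{1..n}) : 'S_n :=
  if [pick s : 'S_n | (cact s lam == mu) &&
        [forall s' : 'S_n, (cact s' lam == mu) ==> (plength s <= plength s')%N]]
  is Some s then s else 1%g.

Definition fstar n (lam mu : 'X_{1..n}) : {mpoly Kqt[n]} :=
  Tperm (sigma_of lam mu) (Estar lam).

Definition is_partition n (lam : 'X_{1..n}) : bool :=
  [forall i : 'I_n, forall j : 'I_n, (i <= j)%N ==> (lam j <= lam i)%N].

(* lam_1 (0 if n = 0) *)
Definition part1 n (lam : 'X_{1..n}) : nat := nth 0%N (val (val lam)) 0.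

Definition conjp n (lam : 'X_{1..n}) (i : nat) : nat :=
  #|[set j : 'I_n | (i <= lam j)%N]|.

Definition plen n (lam : 'X_{1..n}) : nat := #|[set j : 'I_n | (0 < lam j)%N]|.

Definition supp n (mu : 'X_{1..n}) : {set 'I_n} := [set i | (0 < mu i)%N].

Definition ones n (k : nat) : 'X_{1..n} := [multinom ((i < k)%N : nat) | i < n].

Definition IsPstar n (lam : 'X_{1..n}) (p : {mpoly Kqt[n]}) : Prop :=
  [/\ p \is symmetric, (msize p <= (mdeg lam).+1)%N, p@_lam = 1 &
      forall nu : 'X_{1..n}, is_partition nu -> (mdeg nu <= mdeg lam)%N ->
        nu != lam -> p.@[tilde nu] = 0].

Definition Pstar n (lam : 'X_{1..n}) : {mpoly Kqt[n]} :=
  epsilon (inhabits 0) (IsPstar lam).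

Definition Sfactor n (S : {set 'I_n}) : {mpoly Kt[n]} :=
  \prod_(i in S)
     ('X_i - (tQ ^+ #|[set j in ~: S | (j < i)%N]| / tQ ^+ n.-1)%:MP).

Definition estar n (k : nat) : {mpoly Kt[n]} :=
  \sum_(S : {set 'I_n} | #|S| == k) Sfactor S.

(* Main.v *)
Require Import Defs.
From HB Require Import structures.
From mathcomp Require Import all_boot all_order all_algebra all_fingroup.
From mathcomp Require Import fraction ssrcomplements mpoly.
From mathcomp Require Import zify ring.
From Stdlib Require Import ClassicalEpsilon.

Set Implicit Arguments.
Unset Strict Implicit.
Unset Printing Implicit Defensive.

Import Order.TTheory GRing.Theory.
Local Open Scope ring_scope.

(** For every composition [mu], the interpolation polynomial [E*_mu] is built from
    [1] by Hecke intertwiners [T_i - a] and, up to powers of [q], by raising operators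
    [p |-> prod_(i <= k) (x_i - t^(1-n)) * p (x_(k+1), .., x_n, x_1 / q, .., x_k / q)]; both
    preserve vanishing, regularity at [q = 1], a dominance bound on the monomials, and
    unitriangularity of the coefficients of [x^nu], [nu] a rearrangement of [mu], with respect
    to the number of inversions of [nu].  Hence an element of the span [U_lam] of the [E*_nu],
    [nu] in [S_n(lam)], is determined by its coefficients on [S_n(lam)]; as [T_i] acts on these
    in the obvious way, [f*_mu] is the element of [U_lam] with coefficients [delta_mu], whatever
    reduced word is used.

    At [q = 1] the Hecke and raising operators are linear over symmetric polynomials, and the
    intertwining relation at an ascent of an increasing [mu] degenerates to [T_i E = t E], so
    that [E*_mu] is symmetric.  If [A] is the value at [q = 1] of [E*_mu] for [mu] the increasing
    rearrangement of [lam] with its first column removed, then [Sfactor {1..k} * A], with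
    [k = lam'_1], is a raised polynomial and lies in [U_lam]; applying the [T_i], so does
    [Sfactor S * A] for every [S] of size [k], and its coefficient at [x^nu] is 1 if
    [Supp nu = S] and 0 otherwise.  This gives the first formula, and summing over [S] computes
    [A] recursively as a product of [e*]'s.  For generic [q] the sum of all [f*_mu] has equal
    coefficients on [S_n(lam)], hence is fixed by Hecke operators and equals [P*_lam]. *)

(** * Linear maps given by their values on monomials *)

Section LinearExtension.

Variables (R : nzRingType) (V : lmodType R) (n : nat).
Implicit Types (F : 'X_{1..n} -> V) (p : {mpoly R[n]}).

Definition mlift F p : V := \sum_(m <- msupp p) p@_m *: F m.

Lemma mliftwE F k p : (msize p <= k)%N ->
  mlift F p = \sum_(m : 'X_{1..n < k}) p@_m *: F m.
Proof.
move=> le_pk; rewrite /mlift (big_mksub 'X_{1..n < k}) ?msupp_uniq //=; last first.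
  by move=> m /msize_mdeg_lt/leq_trans; apply.
by rewrite big_rmcond //= => m /memN_msupp_eq0->; rewrite scale0r.
Qed.

Lemma mlift_is_linear F : linear (mlift F).
Proof.
move=> c p r; pose k := (msize p + msize r + msize (c *: p + r))%N.
rewrite !(@mliftwE _ k) /k; try lia.
by rewrite scaler_sumr -big_split; apply: eq_bigr => m _; rewrite linearP scalerDl scalerA.
Qed.

HB.instance Definition _ F :=
  GRing.isLinear.Build R {mpoly R[n]} V *:%R (mlift F) (mlift_is_linear F).

Lemma mliftX F m : mlift F 'X_[m] = F m.
Proof. by rewrite /mlift msuppX big_seq1 mcoeffX eqxx scale1r. Qed.

End LinearExtension.

Lemma mcoeff_mlift (R : nzRingType) n (F : 'X_{1..n} -> {mpoly R[n]}) p k :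
  (mlift F p)@_k = \sum_(m <- msupp p) p@_m * (F m)@_k.
Proof. by rewrite raddf_sum; apply: eq_bigr => m _; rewrite /= mcoeffZ. Qed.

Lemma mcoeff_mlift_neq0 (R : nzRingType) n (F : 'X_{1..n} -> {mpoly R[n]}) p k :
  (mlift F p)@_k != 0 -> exists2 m, p@_m != 0 & (F m)@_k != 0.
Proof.
case: (boolP (has (fun m => (F m)@_k != 0) (msupp p))) => [/hasP[m pm Fm] _|/hasPn F0].
  by exists m; rewrite // -mcoeff_msupp.
rewrite mcoeff_mlift big1_seq ?eqxx // => m /F0.
by rewrite negbK => /eqP->; rewrite mulr0.
Qed.

Lemma mcoeff_mlift_diag (R : nzRingType) n (c : 'X_{1..n} -> R) (p : {mpoly R[n]}) k :
  (mlift (fun m => c m *: 'X_[m]) p)@_k = p@_k * c k.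
Proof.
rewrite mcoeff_mlift [in RHS](mpolyE p) raddf_sum mulr_suml; apply: eq_bigr => m _ /=.
by rewrite !mcoeffZ mcoeffX; case: (m =P k) => [->|_]; rewrite ?mulr1 // !mulr0 mul0r.
Qed.

(** * Permutations of variables *)

Local Notation "m # s" := [multinom m (s i) | i < _]
  (at level 40, left associativity, format "m # s").

Lemma meval_msym (R : comNzRingType) n (s : 'S_n) (p : {mpoly R[n]}) (v : 'I_n -> R) :
  (msym s p).@[v] = p.@[v \o s].
Proof.
rewrite [in LHS](mpolyE p) [msym s _]linear_sum raddf_sum /= mevalE; apply: eq_bigr => m _.
rewrite msymZ mevalZ msymX mevalX; congr (_ * _).
rewrite (reindex_inj (@perm_inj _ s)); apply: eq_bigr => i _.
by rewrite mnmE permK.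
Qed.

Section MonomialSwap.

Variable n : nat.
Implicit Types (a b j : 'I_n) (m : 'X_{1..n}).

Definition mswap a b m : 'X_{1..n} := m # (tperm a b).

Lemma mswapE a b m j : mswap a b m j = m (tperm a b j).
Proof. exact: mnmE. Qed.

Lemma mswapL a b m : mswap a b m a = m b.
Proof. by rewrite mswapE tpermL. Qed.

Lemma mswapR a b m : mswap a b m b = m a.
Proof. by rewrite mswapE tpermR. Qed.

Lemma mswapK a b : involutive (mswap a b).
Proof. by move=> m; apply/mnmP=> j; rewrite !mswapE tpermK. Qed.

Lemma mswap_id a b m : m a = m b -> mswap a b m = m.
Proof. by move=> e; apply/mnmP=> j; rewrite mswapE; case: tpermP => // ->. Qed.

Lemma mswap_neq a b m : m a != m b -> mswap a b m != m.
Proof. by apply: contraNneq => e; rewrite -[in m a]e mswapL. Qed.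

Lemma mdeg_mswap a b m : mdeg (mswap a b m) = mdeg m.
Proof. exact: mdeg_mperm. Qed.

Definition mset2 a b m (u v : nat) : 'X_{1..n} :=
  [multinom if j == a then u else if j == b then v else m j | j < n].

Lemma mset2_id a b m : mset2 a b m (m a) (m b) = m.
Proof. by apply/mnmP=> j; rewrite mnmE; case: eqP => [->|_] //; case: eqP => [->|]. Qed.

Lemma mset2_mswap a b m : mset2 a b m (m b) (m a) = mswap a b m.
Proof.
apply/mnmP=> j; rewrite !mnmE; case: tpermP => [->|->|/eqP/negPf-> /eqP/negPf->] //.
  by rewrite eqxx.
by rewrite eqxx; case: eqP => // ->.
Qed.

Lemma mpolyX_mset2 (R : comNzRingType) a b m u v : a != b ->
  'X_[mset2 a b m u v] = 'X_[mset2 a b m 0 0] * 'X_a ^+ u * 'X_b ^+ v :> {mpoly R[n]}.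
Proof.
move=> ab; rewrite !mpolyXn -!mpolyXD; congr 'X_[_]; apply/mnmP=> j.
rewrite !mnmE !mulmnE !mnm1E !(eq_sym _ j).
by case: (j =P a) => [->|_]; [rewrite (negPf ab)|case: (j =P b) => _]; lia.
Qed.

Lemma msym_tpermX (R : nzRingType) a b m :
  msym (tperm a b) ('X_[m] : {mpoly R[n]}) = 'X_[mswap a b m].
Proof. by rewrite msymX tpermV. Qed.

Lemma msym_tpermK (R : nzRingType) a b : involutive (@msym n R (tperm a b)).
Proof. by move=> p; rewrite -msymMm tperm2 msym1m. Qed.

Lemma msymXU (R : nzRingType) (s : 'S_n) i : msym s 'X_i = 'X_(s i) :> {mpoly R[n]}.
Proof. by rewrite /msym mmapX mmap1U. Qed.

Lemma msymC (R : nzRingType) (s : 'S_n) c : msym s c%:MP = c%:MP :> {mpoly R[n]}.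
Proof. exact: mmapC. Qed.

End MonomialSwap.

(** * Demazure-Lusztig operators *)

Section DemazureLusztig.

Variables (R : idomainType) (n : nat).
Implicit Types (t c : R) (a b : 'I_n) (m : 'X_{1..n}) (f g : {mpoly R[n]}).

Lemma mpolyXUB_neq0 a b : a != b -> ('X_a - 'X_b : {mpoly R[n]}) != 0.
Proof.
move=> ab; rewrite subr_eq0; apply: contraNneq ab => /(congr1 (mcoeff U_(a))).
rewrite !mcoeffXU eqxx eq_sym; case: eqP => // _ /eqP.
by rewrite oner_eq0.
Qed.

Lemma dvd_mswapB a b m : a != b ->
  exists g : {mpoly R[n]}, ('X_a - 'X_b) * g = 'X_[m] - 'X_[mswap a b m].
Proof.
move=> ab; wlog le_ba : m / (m b <= m a)%N => [wlog_le|].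
  case: (leqP (m b) (m a)) => [/wlog_le//|/ltnW lt_ab].
  have [|g gE] := wlog_le (mswap a b m); first by rewrite mswapL mswapR.
  by exists (- g); rewrite mulrN gE mswapK opprB.
rewrite -{1}(mset2_id a b m) -mset2_mswap !(mpolyX_mset2 _ m (m _) _ ab).
have := subrXX ('X_a : {mpoly R[n]}) 'X_b (m a - m b); set h := (X in _ * X) => hE.
exists ('X_[mset2 a b m 0 0] * 'X_a ^+ m b * 'X_b ^+ m b * h).
by rewrite mulrCA -hE -[in RHS](subnK le_ba) !exprD; ring.
Qed.

Lemma dvd_msymB a b f : a != b -> exists g, ('X_a - 'X_b) * g = f - msym (tperm a b) f.
Proof.
move=> ab; rewrite [f]mpolyE; elim: (msupp f) => [|m s [g gE]].
  by exists 0; rewrite big_nil raddf0 subr0 mulr0.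
have [h hE] := dvd_mswapB m ab; exists (f@_m *: h + g).
rewrite big_cons mulrDr gE -scalerAr hE msymD msymZ msym_tpermX scalerBr.
by rewrite opprD addrACA.
Qed.

Definition hecke_stay t a b m : R :=
  if m a == m b then t else if (m b < m a)%N then 0 else t - 1.
Definition hecke_swap t a b m : R :=
  if m a == m b then 0 else if (m b < m a)%N then 1 else t.
Definition hecke_between t a b m : R := if (m b < m a)%N then 1 - t else t - 1.

Definition sum_between a b m : {mpoly R[n]} :=
  let u := maxn (m a) (m b) in let v := minn (m a) (m b) in
  \sum_(j < (u - v).-1) 'X_[mset2 a b m (u.-1 - j) (v.+1 + j)].

Definition heckeX t a b m : {mpoly R[n]} :=
  hecke_stay t a b m *: 'X_[m] + hecke_swap t a b m *: 'X_[mswap a b m]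
  + hecke_between t a b m *: sum_between a b m.

(* The operator [t - (t x_a - x_b) / (x_a - x_b) (1 - s_ab)], expanded on monomials. *)
Definition hecke t a b : {mpoly R[n]} -> {mpoly R[n]} := mlift (heckeX t a b).

HB.instance Definition _ t a b := GRing.Linear.on (hecke t a b).

Lemma hecke_stayDswap t a b m :
  hecke_stay t a b m + hecke_swap t a b (mswap a b m) = t.
Proof.
rewrite /hecke_stay /hecke_swap mswapL mswapR.
by case: (ltngtP (m a) (m b)) => _; rewrite ?subrK ?add0r ?addr0.
Qed.

Lemma hecke_stay_desc t a b m : (m b < m a)%N -> hecke_stay t a b m = 0.
Proof. by rewrite /hecke_stay => desc; rewrite desc gtn_eqF. Qed.

Lemma hecke_swap_desc t a b m : (m b < m a)%N -> hecke_swap t a b m = 1.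
Proof. by rewrite /hecke_swap => desc; rewrite desc gtn_eqF. Qed.

Lemma sum_betweenE a b m : a != b ->
  let u := maxn (m a) (m b) in let v := minn (m a) (m b) in (v < u)%N ->
  ('X_a - 'X_b) * sum_between a b m
  = 'X_[mset2 a b m 0 0] * ('X_a ^+ u * 'X_b ^+ v.+1 - 'X_a ^+ v.+1 * 'X_b ^+ u).
Proof.
move=> ab u v lt_vu; rewrite /sum_between -/u -/v; set d := (u - v).-1.
have uE : u = (d + v.+1)%N by rewrite /d; lia.
rewrite [in RHS]uE; have := subrXX ('X_a : {mpoly R[n]}) 'X_b d; set h := (X in _ * X) => hE.
have -> : \sum_(j < d) 'X_[mset2 a b m (u.-1 - j) (v.+1 + j)]
    = 'X_[mset2 a b m 0 0] * 'X_a ^+ v.+1 * 'X_b ^+ v.+1 * h.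
  rewrite mulr_sumr; apply: eq_bigr => j _; rewrite (mpolyX_mset2 _ m _ _ ab).
  have -> : (u.-1 - j = v.+1 + (d.-1 - j))%N by have := ltn_ord j; lia.
  by rewrite !exprD -!mulrA; congr (_ * (_ * _)); exact: mulrCA.
rewrite mulrCA -hE !exprD.
move: 'X_[_] ('X_a ^+ d) ('X_b ^+ d) ('X_a ^+ v.+1) ('X_b ^+ v.+1) => *; ring.
Qed.

Lemma heckeXE t a b m : a != b ->
  ('X_a - 'X_b) * heckeX t a b m =
  (1 - t)%:MP * 'X_b * 'X_[m] + (t%:MP * 'X_a - 'X_b) * 'X_[mswap a b m].
Proof.
move=> ab; rewrite /heckeX !mulrDr -!mul_mpolyC [_ * (_ * sum_between _ _ _)]mulrCA.
have mE := mpolyX_mset2 R m (m a) (m b) ab; rewrite mset2_id in mE.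
have smE := mpolyX_mset2 R m (m b) (m a) ab; rewrite mset2_mswap in smE.
rewrite mE smE; have := @sum_betweenE a b m ab; rewrite /= /hecke_stay /hecke_swap /hecke_between.
case: (ltngtP (m a) (m b)) => [lt_ab|lt_ba|eq_ab].
- by move=> /(_ lt_ab)->; rewrite !rmorphB !rmorph1 !exprS /=; ring.
- by move=> /(_ lt_ba)->; rewrite !rmorphB rmorph0 !rmorph1 !exprS /=; ring.
- move=> _; rewrite /sum_between eq_ab maxnn minnn subnn /= big_ord0.
  by rewrite !rmorphB rmorph0 !rmorph1 /=; ring.
Qed.

Lemma heckeE t a b f : a != b ->
  ('X_a - 'X_b) * hecke t a b f =
  (1 - t)%:MP * 'X_b * f + (t%:MP * 'X_a - 'X_b) * msym (tperm a b) f.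
Proof.
move=> ab; rewrite (mpolyE f) !linear_sum /= !mulr_sumr -big_split /=.
apply: eq_bigr => m _; rewrite !linearZ /= /hecke mliftX msym_tpermX -!scalerAr -scalerDr.
by rewrite heckeXE.
Qed.

Lemma heckeP t a b f g : a != b ->
  ('X_a - 'X_b) * g =
    (1 - t)%:MP * 'X_b * f + (t%:MP * 'X_a - 'X_b) * msym (tperm a b) f ->
  hecke t a b f = g.
Proof. by move=> ab; rewrite -heckeE // => /(mulfI (mpolyXUB_neq0 ab)). Qed.

Lemma hecke_quadratic t a b f : a != b ->
  hecke t a b (hecke t a b f) = (t - 1) *: hecke t a b f + t *: f.
Proof.
(* Eliminate [s_ab h] between the equation defining [h = hecke t a b f] and its image by [s_ab]. *)
move=> ab; apply: heckeP => //; apply: (mulfI (mpolyXUB_neq0 ab)).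
have hE := heckeE t f ab; have := congr1 (msym (tperm a b)) hE.
rewrite !(msymM, msymD, msymN, msymXU, msymC) tpermL tpermR msym_tpermK.
set h := hecke t a b f in hE *; set h' := msym _ h; set f' := msym _ f in hE * => h'E.
rewrite -!mul_mpolyC.
transitivity (('X_a - 'X_b) * (t - 1)%:MP * (('X_a - 'X_b) * h)
              + ('X_a - 'X_b) ^+ 2 * (t%:MP * f)); first by ring.
transitivity ((1 - t)%:MP * 'X_b * (('X_a - 'X_b) * h)
              - (t%:MP * 'X_a - 'X_b) * (('X_b - 'X_a) * h')); last by ring.
by rewrite hE h'E !rmorphB !rmorph1 /=; ring.
Qed.

Lemma hecke_mulsym t a b f g : a != b -> msym (tperm a b) g = g ->
  hecke t a b (f * g) = hecke t a b f * g.
Proof. by move=> ab gsym; apply: heckeP => //; rewrite mulrA heckeE // msymM gsym; ring. Qed.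

Lemma hecke_linear_factor t c a b f : a != b -> msym (tperm a b) f = f ->
  hecke t a b (('X_a - c%:MP) * f) = ('X_b - (t * c)%:MP) * f.
Proof.
move=> ab fsym; rewrite hecke_mulsym //; congr (_ * _); apply: heckeP => //.
by rewrite msymB msymXU msymC tpermL rmorphM !rmorphB rmorph1 /=; ring.
Qed.

Lemma hecke_eigen_sym t a b f : a != b -> t != 0 ->
  hecke t a b f = t *: f -> msym (tperm a b) f = f.
Proof.
move=> ab t_neq0 tf; have := heckeE t f ab; rewrite tf => /eqP.
rewrite -subr_eq0 -mul_mpolyC rmorphB rmorph1 /=.
have -> : ('X_a - 'X_b) * (t%:MP * f)
    - ((1 - t%:MP) * 'X_b * f + (t%:MP * 'X_a - 'X_b) * msym (tperm a b) f)
  = (t%:MP * 'X_a - 'X_b) * (f - msym (tperm a b) f) by ring.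
rewrite mulf_eq0 [X in _ || X]subr_eq0 => /orP[/eqP/(congr1 (mcoeff U_(a)))|/eqP//].
rewrite mcoeffB mcoeffCM !mcoeffXU eqxx eq_sym (negPf ab) mcoeff0 subr0 mulr1.
by move/eqP; rewrite (negPf t_neq0).
Qed.

Lemma meval_hecke t a b f (v : 'I_n -> R) : a != b ->
  (v a - v b) * (hecke t a b f).@[v] =
  (1 - t) * v b * f.@[v] + (t * v a - v b) * f.@[v \o tperm a b].
Proof.
move=> ab; have := congr1 (meval v) (heckeE t f ab).
by rewrite !(mevalM, mevalD, mevalN, mevalC, mevalXU) meval_msym.
Qed.

Definition between a b m m' : Prop :=
  [/\ forall l, l != a -> l != b -> m' l = m l, (m' a + m' b = m a + m b)%N,
      (minn (m a) (m b) < m' a)%N & (m' a < maxn (m a) (m b))%N].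

Lemma sum_between_supp a b m m' : a != b -> (sum_between a b m)@_m' != 0 -> between a b m m'.
Proof.
move=> ab; rewrite /sum_between raddf_sum /=.
set u := maxn _ _; set v := minn _ _ => nz.
have /existsP[j /eqP<-] :
    [exists j : 'I_(u - v).-1, mset2 a b m (u.-1 - j) (v.+1 + j) == m'].
  apply: contraR nz => /existsPn no_j.
  by rewrite big1 // => j _; rewrite mcoeffX (negPf (no_j j)).
have := ltn_ord j; rewrite /between !mnmE !eqxx eq_sym (negPf ab) => lt_j.
by split; try lia; move=> l la lb; rewrite mnmE (negPf la) (negPf lb).
Qed.

Lemma hecke_supp t a b f m' : a != b -> (hecke t a b f)@_m' != 0 ->
  exists2 m, f@_m != 0 & [\/ m' = m, m' = mswap a b m | between a b m m'].
Proof.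
move=> ab /mcoeff_mlift_neq0[m fm Fm]; exists m => //; move: Fm.
rewrite /heckeX !mcoeffD !mcoeffZ !mcoeffX.
case: (m =P m') => [->|_]; first by constructor 1.
case: (mswap a b m =P m') => [->|_]; first by constructor 2.
rewrite !mulr0 !add0r => nz; constructor 3; apply: sum_between_supp => //.
by apply: contraNneq nz => ->; rewrite mulr0.
Qed.

Lemma mcoeff_hecke_not_between t a b f k : a != b ->
  (forall m, f@_m != 0 -> ~ between a b m k) ->
  (hecke t a b f)@_k = hecke_stay t a b k * f@_k
                       + hecke_swap t a b (mswap a b k) * f@_(mswap a b k).
Proof.
move=> ab not_bt; rewrite ![_ * f@_ _]mulrC -!(mcoeff_mlift_diag (fun m => _ m)).
rewrite !mcoeff_mlift -big_split; apply: eq_big_seq => m mf /=.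
rewrite /heckeX !mcoeffD !mcoeffZ !mcoeffX -mulrDr.
have -> : (sum_between a b m)@_k = 0.
  by apply/eqP/negPn/negP => /(sum_between_supp ab); apply: not_bt; rewrite -mcoeff_msupp.
by rewrite mulr0 addr0 (can2_eq (mswapK a b) (mswapK a b)).
Qed.

End DemazureLusztig.

(** * Compositions and inversions *)

Section Compositions.

Variable n : nat.
Implicit Types (mu nu lam : 'X_{1..n}) (a b j l : 'I_n) (i : 'I_n.-1).

Lemma hi_ixE i : hi_ix i = (lo_ix i).+1 :> nat.
Proof. by rewrite /hi_ix val_insubd /=; have := ltn_ord i; case: ifP => //; lia. Qed.

Lemma lo_hi_neq i : lo_ix i != hi_ix i.
Proof. by rewrite -val_eqE /= hi_ixE /= ltn_eqF. Qed.

Lemma tperm_valE a b j :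
  tperm a b j = (if j == a :> nat then b else if j == b :> nat then a else j) :> nat.
Proof.
rewrite !val_eqE; case: tpermP => [->|->|/eqP/negPf-> /eqP/negPf->]; rewrite ?eqxx //.
by case: eqP => // ->.
Qed.

Lemma ltn_tperm_adj a b j l : b = a.+1 :> nat -> (j, l) != (a, b) -> (j, l) != (b, a) ->
  (tperm a b j < tperm a b l)%N = (j < l)%N.
Proof.
move=> bE; rewrite !xpair_eqE -!val_eqE !tperm_valE /=.
by do 4!case: eqP; lia.
Qed.

Definition outranks mu l j : bool := (mu j < mu l)%N || ((mu j == mu l) && (j < l)%N).

Lemma kidxE mu j : kidx mu j = #|[set l | outranks mu l j]|.
Proof.
rewrite /kidx -cardsUI [X in (_ + X)%N](_ : _ = 0%N) ?addn0; last first.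
  by apply: eq_card0 => l; rewrite !inE; lia.
apply: eq_card => l; rewrite !inE /outranks.
by have [->|] := eqVneq l j; [|rewrite -val_eqE /=]; lia.
Qed.

Lemma ltn_kidx mu l j : outranks mu l j -> (kidx mu l < kidx mu j)%N.
Proof.
move=> lj; rewrite !kidxE; apply: proper_card; apply/properP; split.
  by apply/subsetP => x; rewrite !inE; move: lj; rewrite /outranks; lia.
by exists l; rewrite !inE // /outranks; lia.
Qed.

Lemma kidx_inj mu : injective (kidx mu).
Proof.
move=> j l eq_k; apply/eqP/negPn/negP => jl; have {}jl : j != l :> nat by [].
have /orP[] : outranks mu j l || outranks mu l j by rewrite /outranks; lia.
  by move/ltn_kidx; rewrite eq_k ltnn.
by move/ltn_kidx; rewrite eq_k ltnn.
Qed.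

Lemma kidx_reindex (s : 'S_n) mu nu j :
  (forall l k, outranks nu l k = outranks mu (s l) (s k)) -> kidx nu j = kidx mu (s j).
Proof.
move=> s_rank; rewrite !kidxE -[in RHS](card_preimset _ (@perm_inj _ s)).
by apply: eq_card => l; rewrite !inE s_rank.
Qed.

Lemma kidx_mswap a b mu j : b = a.+1 :> nat -> mu a != mu b ->
  kidx (mswap a b mu) j = kidx mu (tperm a b j).
Proof.
move=> bE ab_neq; apply: kidx_reindex => l k; rewrite /outranks !mswapE.
have [[-> ->]|kl_ab] := eqVneq (k, l) (a, b).
  by rewrite tpermL tpermR [mu b == _]eq_sym (negPf ab_neq).
have [[-> ->]|kl_ba] := eqVneq (k, l) (b, a).
  by rewrite tpermL tpermR (negPf ab_neq).
by rewrite ltn_tperm_adj.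
Qed.

Lemma kidx_succ a b mu :
  (forall l, l != b -> outranks mu l a = outranks mu l b) -> outranks mu b a ->
  kidx mu a = (kidx mu b).+1.
Proof.
move=> same_rank ba; rewrite !kidxE.
have -> : [set l | outranks mu l a] = b |: [set l | outranks mu l b].
  by apply/setP=> l; rewrite !inE; have [->|/same_rank->] := eqVneq l b.
by rewrite cardsU1 inE /outranks !ltnn andbF.
Qed.

Lemma kidx_flat a b mu : b = a.+1 :> nat -> mu a = mu b -> kidx mu a = (kidx mu b).+1.
Proof.
move=> bE flat; apply: kidx_succ => [l|]; last by rewrite /outranks; lia.
by rewrite -val_eqE /outranks flat /=; lia.
Qed.

Lemma kidx_first_zero mu j : mu j = 0%N -> (forall l, (l < j)%N -> (0 < mu l)%N) ->
  kidx mu j = n.-1.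
Proof.
move=> z pos; rewrite kidxE -[in RHS](card_ord n) -(cardsC1 j); apply: eq_card => l.
rewrite !inE /outranks z -val_eqE /=; have := pos l.
case: (ltngtP l j) => [_ /(_ isT)|_|lj _]; [lia|lia|by rewrite (ord_inj lj) z].
Qed.

Definition inversions mu : nat :=
  #|[set p : 'I_n * 'I_n | (p.1 < p.2)%N && (mu p.1 < mu p.2)%N]|.

Lemma leq_inversions mu : (inversions mu <= n * n)%N.
Proof. by apply: leq_trans (max_card _) _; rewrite card_prod card_ord. Qed.

Lemma inversions_mswap a b mu : b = a.+1 :> nat -> (mu b < mu a)%N ->
  inversions (mswap a b mu) = (inversions mu).+1.
Proof.
move=> bE lt_ba; pose f (p : 'I_n * 'I_n) := (tperm a b p.1, tperm a b p.2).
have fI : injective f by move=> [x y] [x' y'] [/perm_inj-> /perm_inj->].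
rewrite /inversions -[in RHS](card_preimset _ fI).
have -> : [set p : 'I_n * 'I_n | (p.1 < p.2)%N && (mswap a b mu p.1 < mswap a b mu p.2)%N]
   = (a, b) |: f @^-1: [set p : 'I_n * 'I_n | (p.1 < p.2)%N && (mu p.1 < mu p.2)%N].
  apply/setP=> -[x y]; rewrite !inE /f /= !mswapE.
  have [[-> ->]|xy_ab] := eqVneq (x, y) (a, b); first by rewrite tpermL tpermR; lia.
  have [[-> ->]|xy_ba] := eqVneq (x, y) (b, a); first by rewrite tpermL tpermR; lia.
  by rewrite ltn_tperm_adj.
by rewrite cardsU1 !inE /f /= tpermL tpermR; lia.
Qed.

Definition aswap i mu := mswap (lo_ix i) (hi_ix i) mu.

Lemma aswapK i : involutive (aswap i).
Proof. exact: mswapK. Qed.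

Definition descent i mu : bool := (mu (hi_ix i) < mu (lo_ix i))%N.

Definition ascent i mu : bool := (mu (lo_ix i) < mu (hi_ix i))%N.

Lemma descent_neq i mu : descent i mu -> mu (lo_ix i) != mu (hi_ix i).
Proof. by move=> desc; rewrite neq_ltn orbC -/(descent i mu) desc. Qed.

Lemma descent_aswap i mu : descent i (aswap i mu) = ascent i mu.
Proof. by rewrite /descent mswapL mswapR. Qed.

Lemma aswap_neq i mu : descent i mu -> aswap i mu != mu.
Proof. by move=> desc; apply/mswap_neq/descent_neq. Qed.

Lemma inversions_desc i mu : descent i mu ->
  inversions (aswap i mu) = (inversions mu).+1.
Proof. exact/inversions_mswap/hi_ixE. Qed.

Lemma inversions_asc i mu : ascent i mu ->
  inversions mu = (inversions (aswap i mu)).+1.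
Proof. by rewrite -descent_aswap => /inversions_desc; rewrite aswapK. Qed.

Lemma inversions_aswap_le i mu : (inversions (aswap i mu) <= (inversions mu).+1)%N.
Proof.
case: (ltngtP (mu (lo_ix i)) (mu (hi_ix i))) => [/inversions_asc->|/inversions_desc->|flat].
- by rewrite leqW // leqW.
- by [].
- by rewrite /aswap mswap_id.
Qed.

Lemma inversions_le_aswap i mu : (inversions mu <= (inversions (aswap i mu)).+1)%N.
Proof. by rewrite -{1}(aswapK i mu) inversions_aswap_le. Qed.

Definition rearr mu nu : bool := perm_eq (val (val mu)) (val (val nu)).

Lemma rearrP mu nu : reflect (exists s : 'S_n, mu = nu # s) (rearr mu nu).
Proof.
apply: (iffP tuple_permP) => -[s e]; exists s.
  by apply: val_inj; apply: val_inj; rewrite e.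
by rewrite e.
Qed.

Lemma rearr_refl mu : rearr mu mu.
Proof. exact: perm_refl. Qed.

Lemma rearr_sym mu nu : rearr mu nu = rearr nu mu.
Proof. exact: perm_sym. Qed.

Lemma rearr_trans : transitive rearr.
Proof. by move=> nu mu lam; exact: perm_trans. Qed.

Lemma rearr_mperm (s : 'S_n) mu : rearr (mu # s) mu.
Proof. by apply/rearrP; exists s. Qed.

Lemma rearr_mswapl a b mu nu : rearr (mswap a b mu) nu = rearr mu nu.
Proof.
apply/idP/idP; apply: rearr_trans; last exact: rearr_mperm.
by rewrite rearr_sym rearr_mperm.
Qed.

Lemma rearr_aswap i mu nu : rearr (aswap i mu) nu = rearr mu nu.
Proof. exact: rearr_mswapl. Qed.

Lemma sum_rearr mu nu (F : nat -> nat) : rearr mu nu ->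
  (\sum_j F (mu j) = \sum_j F (nu j))%N.
Proof.
case/rearrP=> s ->; rewrite [RHS](reindex_inj (@perm_inj _ s)).
by apply: eq_bigr => j _; rewrite mnmE.
Qed.

Lemma mdeg_rearr mu nu : rearr mu nu -> mdeg mu = mdeg nu.
Proof. by rewrite !mdegE; exact: (sum_rearr id). Qed.

Lemma conjp_rearr mu nu c : rearr mu nu -> conjp mu c = conjp nu c.
Proof.
rewrite /conjp -!sum1dep_card big_mkcond [RHS]big_mkcond /=.
exact: (sum_rearr (fun v => if (c <= v)%N then 1 else 0)%N).
Qed.

Lemma partitionP lam :
  reflect (forall j l, (j <= l)%N -> (lam l <= lam j)%N) (is_partition lam).
Proof.
apply: (iffP forallP) => dec j; last by apply/forallP=> l; apply/implyP; apply: dec.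
by move=> l jl; have /forallP/(_ l)/implyP := dec j; apply.
Qed.

Lemma partition_sorted lam : is_partition lam = sorted geq (val (val lam)).
Proof.
apply/partitionP/(sortedP 0%N) => [dec j|sorted_lam j l le_jl].
  rewrite size_tuple => lt_j; have := dec (Ordinal (ltnW lt_j)) (Ordinal lt_j) (leqnSn _).
  by rewrite !(mnm_nth 0%N).
have geq_trans : transitive geq by move=> x y z; lia.
rewrite !(mnm_nth 0%N); apply: (sorted_leq_nth geq_trans leqnn 0%N _ j l) le_jl.
- exact/(sortedP 0%N).
- by rewrite inE size_tuple.
- by rewrite inE size_tuple.
Qed.

Lemma ascent_exists mu : ~~ is_partition mu -> exists i, ascent i mu.
Proof.
move=> not_part; apply/existsP; apply: contraR not_part => /existsPn no_ascent.
rewrite partition_sorted; apply/(sortedP 0%N) => j; rewrite size_tuple => lt_j.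
have lt_j1 : (j < n.-1)%N by lia.
by have := no_ascent (Ordinal lt_j1); rewrite /ascent -leqNgt !(mnm_nth 0%N) hi_ixE.
Qed.

Lemma rearr_partition lam mu : is_partition lam -> is_partition mu -> rearr lam mu -> lam = mu.
Proof.
rewrite !partition_sorted => lam_sorted mu_sorted lam_mu; do 2!apply: val_inj.
by apply: sorted_eq lam_sorted mu_sorted lam_mu => [x y z|x y]; lia.
Qed.

Lemma partition_aswap_ind (P : 'X_{1..n} -> Prop) :
  (forall lam, is_partition lam -> P lam) ->
  (forall mu i, descent i mu -> P mu -> P (aswap i mu)) ->
  forall mu, P mu.
Proof.
move=> P_part P_swap mu; have [k] := ubnP (inversions mu); elim: k mu => // k IHk mu lt_mu.
have [/P_part//|/ascent_exists[i lt_i]] := boolP (is_partition mu).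
rewrite -(aswapK i mu); apply: P_swap; first by rewrite descent_aswap.
by apply: IHk; move: lt_mu; rewrite (inversions_asc lt_i).
Qed.

End Compositions.

(** * Dominance *)

Section Dominance.

Variable n : nat.
Implicit Types (mu nu m : 'X_{1..n}) (a b : 'I_n).

(* Weak submajorization, tested on the functions [x |-> (x - c)^+]. For [mdeg m = mdeg mu] this is
   the dominance order on the sorted compositions. *)
Definition dominates mu m : Prop := forall c, (\sum_j (m j - c) <= \sum_j (mu j - c))%N.

Lemma sum_subn0 m : (\sum_j (m j - 0) = mdeg m)%N.
Proof. by rewrite mdegE; apply: eq_bigr => j _; rewrite subn0. Qed.

Lemma dominates_mdeg mu m : dominates mu m -> (mdeg m <= mdeg mu)%N.
Proof. by move/(_ 0%N); rewrite !sum_subn0. Qed.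

Lemma dominates_rearrl mu nu m : rearr mu nu -> dominates mu m -> dominates nu m.
Proof. by move=> mu_nu dom c; rewrite -(sum_rearr (fun v => v - c)%N mu_nu). Qed.

Lemma dominates_rearrr mu m m' : rearr m m' -> dominates mu m -> dominates mu m'.
Proof. by move=> m_m' dom c; rewrite -(sum_rearr (fun v => v - c)%N m_m'). Qed.

Lemma sum_between_split a b m m' (F : nat -> nat) : a != b -> between a b m m' ->
  exists r, (\sum_j F (m j) = F (m a) + F (m b) + r)%N
         /\ (\sum_j F (m' j) = F (m' a) + F (m' b) + r)%N.
Proof.
move=> ab [off_ab _ _ _]; exists (\sum_(j | (j != a) && (j != b)) F (m j))%N.
have split_ab (g : 'I_n -> nat) :
    (\sum_j F (g j) = F (g a) + F (g b) + \sum_(j | (j != a) && (j != b)) F (g j))%N.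
  by rewrite (bigD1 a) //= (bigD1 b) 1?eq_sym //= addnA.
split; rewrite split_ab //; congr (_ + _)%N.
by apply: eq_bigr => j /andP[ja jb]; rewrite off_ab.
Qed.

Lemma dominates_between a b mu m m' : a != b ->
  dominates mu m -> between a b m m' -> dominates mu m'.
Proof.
move=> ab dom bt c; apply: leq_trans (dom c).
have [r [-> ->]] := sum_between_split (fun v => v - c)%N ab bt.
by case: bt; lia.
Qed.

Lemma dominates_not_between a b mu m nu : a != b -> rearr nu mu ->
  dominates mu m -> ~ between a b m nu.
Proof.
move=> ab nu_mu dom bt; pose c := maxn (nu a) (nu b).
have := dom c; rewrite -(sum_rearr (fun v => v - c)%N nu_mu).
have [r [-> ->]] := sum_between_split (fun v => v - c)%N ab bt.
by case: bt; rewrite /c; lia.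
Qed.

End Dominance.

(** * Adjacent swaps, words and reduced words *)

Section Words.

Variable n : nat.
Implicit Types (mu nu lam : 'X_{1..n}) (i : 'I_n.-1) (w : seq 'I_n.-1) (s : 'S_n).

Lemma inversions_partition lam : is_partition lam -> inversions lam = 0%N.
Proof.
move/partitionP=> dec; apply: eq_card0 => -[j l]; rewrite !inE /=.
by case: ltnP => //= /ltnW /dec; case: ltnP => //; lia.
Qed.

Definition word_act w lam : 'X_{1..n} := foldr (@aswap n) lam w.

Lemma inversions_word_act w lam : is_partition lam ->
  (inversions (word_act w lam) <= size w)%N.
Proof.
move=> part; elim: w => [|i w IHw] /=; first by rewrite inversions_partition.
exact: leq_trans (inversions_aswap_le _ _) _.
Qed.

(* [w] is a shortest word taking the partition [lam] to [mu]. *)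
Definition reduced_word w lam mu : Prop := word_act w lam = mu /\ size w = inversions mu.

Lemma reduced_word_cons i w lam mu : is_partition lam -> reduced_word (i :: w) lam mu ->
  reduced_word w lam (aswap i mu) /\ ascent i mu.
Proof.
move=> part [<-] /=; rewrite -/(word_act w lam); set kap := word_act w lam.
have le_w : (inversions kap <= size w)%N := inversions_word_act w part.
rewrite aswapK => sz; have desc : descent i kap.
  case: (ltngtP (kap (hi_ix i)) (kap (lo_ix i))) => // [asc|flat].
    by have := inversions_asc asc; lia.
  by move: sz; rewrite /aswap mswap_id //; lia.
by rewrite -descent_aswap aswapK; split=> //; move: sz; rewrite inversions_desc // => -[].
Qed.

Lemma cact_perm_of_word w lam : cact (perm_of_word w) lam = word_act w lam.
Proof.
elim: w => [|i w IHw] /=; first by apply/mnmP=> j; rewrite mnmE invg1 perm1.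
rewrite -/(word_act w lam) -IHw; apply/mnmP=> j.
by rewrite !mnmE invMg permM tpermV.
Qed.

Lemma reduced_word_exists lam mu : is_partition lam -> rearr mu lam ->
  exists w, reduced_word w lam mu.
Proof.
move=> part; elim/partition_aswap_ind: mu => [mu mu_part mu_lam|mu i desc IHmu].
  by exists [::]; split; rewrite ?inversions_partition // (rearr_partition mu_part part).
rewrite rearr_aswap => /IHmu[w [wE sz]].
by exists (i :: w); split; rewrite /= ?wE // sz inversions_desc.
Qed.

Definition staircase : 'X_{1..n} := [multinom (n - j)%N | j < n].

Lemma staircase_partition : is_partition staircase.
Proof. by apply/partitionP=> j l; rewrite !mnmE; lia. Qed.

Lemma cact_staircase_inj : injective (fun s => cact s staircase).
Proof.
move=> s s' /mnmP eq_s; apply: invg_inj; apply/permP=> j; apply: ord_inj.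
have := eq_s j; rewrite /cact /= !mnmE.
have := ltn_ord (s^-1 j)%g; have := ltn_ord (s'^-1 j)%g.
by move: (nat_of_ord _) (nat_of_ord _); lia.
Qed.

Lemma plengthE s : plength s = inversions (cact s staircase).
Proof.
pose f (p : 'I_n * 'I_n) := (s p.2, s p.1).
have fI : injective f by move=> [x y] [x' y'] [/perm_inj-> /perm_inj->].
rewrite /inversions -[in RHS](card_preimset _ fI); apply: eq_card => -[x y].
by rewrite !inE /f /= !mnmE !permK; have := ltn_ord x; have := ltn_ord y; lia.
Qed.

Lemma plength_perm_of_word w : (plength (perm_of_word w) <= size w)%N.
Proof. by rewrite plengthE cact_perm_of_word inversions_word_act // staircase_partition. Qed.

Lemma red_wordP s : perm_of_word (red_word s) = s /\ size (red_word s) = plength s.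
Proof.
rewrite /red_word; case: pickP => [w /eqP e|no_word]; first by rewrite size_tuple.
have stair_s : rearr (cact s staircase) staircase by exact: rearr_mperm.
have [w [wE /eqP]] := reduced_word_exists staircase_partition stair_s.
rewrite -plengthE => sz; have /eqP[] := no_word (Tuple sz).
by apply: cact_staircase_inj; rewrite /= cact_perm_of_word.
Qed.

Definition sigma_word lam mu := red_word (sigma_of lam mu).

Lemma sigma_word_reduced lam mu : is_partition lam -> rearr mu lam ->
  reduced_word (sigma_word lam mu) lam mu.
Proof.
move=> part mu_lam; have [w [wE sz]] := reduced_word_exists part mu_lam.
have w_lam : cact (perm_of_word w) lam == mu by rewrite cact_perm_of_word wE.
have [] := red_wordP (sigma_of lam mu); rewrite /sigma_word; set v := red_word _.
rewrite /sigma_of; case: pickP => [s /andP[/eqP s_lam /forallP s_min]|no_min] vE sz_v.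
  have v_lam : word_act v lam = mu by rewrite -cact_perm_of_word vE.
  split=> //; apply/eqP; rewrite eqn_leq -{2}v_lam inversions_word_act // andbT sz_v -sz.
  have := s_min (perm_of_word w); rewrite w_lam => /leq_trans; apply.
  exact: plength_perm_of_word.
case: (@arg_minnP _ _ (fun s => cact s lam == mu) (@plength n) w_lam) => s s_lam s_min.
have /negP[] := negbT (no_min s); rewrite s_lam /=.
by apply/forallP=> s'; apply/implyP; exact: s_min.
Qed.

End Words.

Lemma symmetric_sadj (R : nzRingType) n (p : {mpoly R[n]}) :
  (forall i : 'I_n.-1, msym (sadj i) p = p) -> p \is symmetric.
Proof.
move=> p_sym; apply/issymP=> s; have [<- _] := red_wordP s.
by elim: (red_word s) => [|i w IHw] /=; rewrite ?msym1m // msymMm IHw p_sym.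
Qed.

(** * Families of polynomials stable under Demazure-Lusztig operators *)

Section LeadingTerms.

Variables (R : idomainType) (n : nat) (t : R).
Implicit Types (mu nu : 'X_{1..n}) (a b : 'I_n) (i : 'I_n.-1) (f g : {mpoly R[n]}).

Definition hecke_adj i : {mpoly R[n]} -> {mpoly R[n]} := hecke t (lo_ix i) (hi_ix i).

HB.instance Definition _ i := GRing.Linear.on (hecke_adj i).

Definition supp_dominated mu f : Prop := forall m, f@_m != 0 -> dominates mu m.

Definition unitriangular mu f : Prop :=
  f@_mu = 1 /\
  forall nu, rearr nu mu -> (inversions mu <= inversions nu)%N -> nu != mu -> f@_nu = 0.

Lemma supp_dominated_msize mu f : supp_dominated mu f -> (msize f <= (mdeg mu).+1)%N.
Proof.
move=> dom; rewrite msizeE; apply/bigmax_leqP_seq => m mf _.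
by apply/dominates_mdeg/dom; rewrite -mcoeff_msupp.
Qed.

Lemma supp_dominated_rearr mu nu f : rearr mu nu -> supp_dominated mu f -> supp_dominated nu f.
Proof. by move=> mu_nu dom m /dom; apply: dominates_rearrl. Qed.

Lemma supp_dominated0 mu : supp_dominated mu 0.
Proof. by move=> m; rewrite mcoeff0 eqxx. Qed.

Lemma supp_dominated_lin mu c f g : supp_dominated mu f -> supp_dominated mu g ->
  supp_dominated mu (c *: f + g).
Proof.
move=> f_dom g_dom m; rewrite mcoeffD mcoeffZ.
have [->|/f_dom//] := eqVneq f@_m 0.
by rewrite mulr0 add0r => /g_dom.
Qed.

Lemma supp_dominatedBZ mu c f g : supp_dominated mu f -> supp_dominated mu g ->
  supp_dominated mu (f - c *: g).
Proof. by move=> f_dom g_dom; rewrite addrC -scaleNr; apply: supp_dominated_lin. Qed.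

Lemma supp_dominated_hecke mu a b f : a != b ->
  supp_dominated mu f -> supp_dominated mu (hecke t a b f).
Proof.
move=> ab dom m /(hecke_supp ab)[m' /dom m'_dom [->|->|]] //; last exact: dominates_between.
by apply: dominates_rearrr m'_dom; rewrite rearr_sym rearr_mperm.
Qed.

Lemma mcoeff_hecke_rearr mu nu a b f : a != b -> supp_dominated mu f -> rearr nu mu ->
  (hecke t a b f)@_nu = hecke_stay t a b nu * f@_nu
                        + hecke_swap t a b (mswap a b nu) * f@_(mswap a b nu).
Proof.
by move=> ab dom nu_mu; apply: mcoeff_hecke_not_between => // m /dom; exact: dominates_not_between.
Qed.

Lemma unitriangular_aswap mu i c f : supp_dominated mu f -> unitriangular mu f ->
  descent i mu -> unitriangular (aswap i mu) (hecke_adj i f - c *: f).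
Proof.
move=> dom [f_mu f_nu] desc; have invE := inversions_desc desc.
have lo_hi := lo_hi_neq i; split=> [|nu nu_mu le_nu nu_neq]; rewrite mcoeffB mcoeffZ.
  have f_swap : f@_(aswap i mu) = 0.
    by apply: f_nu; rewrite ?rearr_aswap ?rearr_refl ?invE ?leqnSn ?aswap_neq.
  rewrite (mcoeff_hecke_rearr lo_hi dom) ?rearr_mperm // f_swap !mulr0 add0r subr0.
  by rewrite mswapK f_mu mulr1 hecke_swap_desc.
have {}nu_mu : rearr nu mu by apply: rearr_trans nu_mu _; exact: rearr_mperm.
rewrite (mcoeff_hecke_rearr lo_hi dom) // (f_nu nu) //; first last.
- by apply: contraTneq le_nu => ->; rewrite invE ltnn.
- by rewrite invE in le_nu; exact: ltnW.
rewrite (f_nu (mswap _ _ nu)) ?rearr_mswapl //; first by rewrite !mulr0 addr0 subr0.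
  by have := inversions_le_aswap i nu; rewrite /aswap; lia.
by apply: contraNneq nu_neq => <-; rewrite aswapK.
Qed.

End LeadingTerms.

Section OrbitSpan.

Variables (R : idomainType) (n : nat) (t : R) (E : 'X_{1..n} -> {mpoly R[n]}).
Implicit Types (mu nu lam : 'X_{1..n}) (i : 'I_n.-1) (f g : {mpoly R[n]}).

Definition orbit_span lam f : Prop := exists c : 'X_{1..n} -> R,
  f = \sum_(nu : 'X_{1..n < (mdeg lam).+1} | rearr nu lam) c nu *: E nu.

Lemma orbit_span_mem lam nu : rearr nu lam -> orbit_span lam (E nu).
Proof.
move=> nu_lam; exists (fun m => (m == nu)%:R).
have lt_nu : (mdeg nu < (mdeg lam).+1)%N by rewrite (mdeg_rearr nu_lam).
rewrite (bigD1 (BMultinom lt_nu)) //= eqxx scale1r big1 ?addr0 // => m /andP[_].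
by rewrite -(inj_eq val_inj) /= => /negPf->; rewrite scale0r.
Qed.

Lemma orbit_span_lin lam c f g :
  orbit_span lam f -> orbit_span lam g -> orbit_span lam (c *: f + g).
Proof.
case=> cf -> [cg ->]; exists (fun m => c * cf m + cg m).
rewrite scaler_sumr -big_split /=; apply: eq_bigr => m _.
by rewrite scalerDl scalerA.
Qed.

Lemma orbit_span0 lam : orbit_span lam 0.
Proof. by exists (fun=> 0); rewrite big1 // => m _; rewrite scale0r. Qed.

Lemma orbit_spanZ lam c f : orbit_span lam f -> orbit_span lam (c *: f).
Proof. by move=> f_span; rewrite -[_ *: _]addr0; apply/orbit_span_lin/orbit_span0. Qed.

Lemma orbit_spanD lam f g : orbit_span lam f -> orbit_span lam g -> orbit_span lam (f + g).
Proof. by move=> f_span; rewrite -[f]scale1r; apply: orbit_span_lin. Qed.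

Lemma orbit_spanB lam f g : orbit_span lam f -> orbit_span lam g -> orbit_span lam (f - g).
Proof. by move=> f_span g_span; rewrite -scaleN1r addrC; apply: orbit_span_lin. Qed.

Lemma orbit_span_sum lam (I : Type) (r : seq I) (P : pred I) (F : I -> {mpoly R[n]}) :
  (forall k, P k -> orbit_span lam (F k)) -> orbit_span lam (\sum_(k <- r | P k) F k).
Proof.
move=> F_span; apply: (big_ind (orbit_span lam)) => //; first exact: orbit_span0.
exact: orbit_spanD.
Qed.

Definition orbit_indicator lam (P : pred 'X_{1..n}) f : Prop :=
  orbit_span lam f /\ forall nu, rearr nu lam -> f@_nu = (P nu)%:R.

Lemma orbit_indicator_ext lam (P Q : pred 'X_{1..n}) f :
  (forall nu, rearr nu lam -> P nu = Q nu) ->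
  orbit_indicator lam P f -> orbit_indicator lam Q f.
Proof. by move=> eq_PQ [span coef]; split=> // nu nu_lam; rewrite coef // eq_PQ. Qed.

Lemma orbit_indicator_sum lam (I : finType) (label : 'X_{1..n} -> I) (Q : pred I)
    (F : I -> {mpoly R[n]}) :
  (forall k, Q k -> orbit_indicator lam (fun nu => label nu == k) (F k)) ->
  orbit_indicator lam (Q \o label) (\sum_(k | Q k) F k).
Proof.
move=> F_ind; split=> [|nu nu_lam]; first by apply: orbit_span_sum => k /F_ind[].
rewrite raddf_sum /= (eq_bigr (fun k => (label nu == k)%:R)) => [|k /F_ind[_ ->] //].
have [Q_nu|notQ_nu] := boolP (Q (label nu)).
  rewrite (bigD1 (label nu)) //= eqxx big1 ?addr0 // => k /andP[_].
  by rewrite eq_sym => /negPf->.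
by rewrite big1 // => k Q_k; case: eqP notQ_nu => // ->; rewrite Q_k.
Qed.

Definition hecke_family : Prop :=
  [/\ forall mu, supp_dominated mu (E mu),
      forall mu, unitriangular mu (E mu),
      forall mu i, descent i mu ->
        exists c, hecke_adj t i (E mu) = E (aswap i mu) + c *: E mu
    & forall mu i, mu (lo_ix i) = mu (hi_ix i) -> hecke_adj t i (E mu) = t *: E mu].

Hypothesis E_family : hecke_family.

Lemma orbit_span_dominated lam f : orbit_span lam f -> supp_dominated lam f.
Proof.
have [E_dom _ _ _] := E_family; case=> c ->; apply: (big_ind (supp_dominated lam)).
- exact: supp_dominated0.
- by move=> f1 f2 f1_dom; rewrite -[f1]scale1r; apply: supp_dominated_lin.
- move=> nu nu_lam; rewrite -[_ *: _]addr0; apply/supp_dominated_lin/supp_dominated0.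
  exact: supp_dominated_rearr nu_lam _.
Qed.

Lemma orbit_span_eq0 lam f :
  orbit_span lam f -> (forall nu, rearr nu lam -> f@_nu = 0) -> f = 0.
Proof.
have [_ E_tri _ _] := E_family; case=> c -> f0.
have c0 (nu : 'X_{1..n < (mdeg lam).+1}) : rearr nu lam -> c nu = 0.
  have [N] := ubnP (n * n - inversions nu); elim: N nu => // N IHN nu lt_N nu_lam.
  have := f0 _ nu_lam; rewrite raddf_sum (bigD1 nu) //= mcoeffZ.
  have [-> _] := E_tri nu; rewrite mulr1 big1 ?addr0 // => kap /andP[kap_lam kap_neq].
  rewrite mcoeffZ; have [le_inv|lt_inv] := leqP (inversions kap) (inversions nu).
    have [_ ->] := E_tri kap; rewrite ?mulr0 // 1?eq_sym //.
    by apply: rearr_trans nu_lam _; rewrite rearr_sym.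
  by have := leq_inversions kap => le_kap; rewrite IHN ?mul0r //; lia.
by rewrite big1 // => nu nu_lam; rewrite c0 // scale0r.
Qed.

Lemma orbit_span_eq lam f g : orbit_span lam f -> orbit_span lam g ->
  (forall nu, rearr nu lam -> f@_nu = g@_nu) -> f = g.
Proof.
move=> f_span g_span eq_fg; apply/subr0_eq/(orbit_span_eq0 (orbit_spanB f_span g_span)).
by move=> nu nu_lam; rewrite mcoeffB eq_fg // subrr.
Qed.

Lemma orbit_indicator_uniq lam P f g :
  orbit_indicator lam P f -> orbit_indicator lam P g -> f = g.
Proof.
move=> [f_span f_coef] [g_span g_coef]; apply: orbit_span_eq f_span g_span _ => nu nu_lam.
by rewrite f_coef // g_coef.
Qed.

(* The quadratic relation turns the action at a descent into the action at an ascent. *)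
Lemma hecke_adj_ascent mu i c : hecke_adj t i (E mu) = E (aswap i mu) + c *: E mu ->
  hecke_adj t i (E (aswap i mu))
    = (t - 1 - c) *: E (aswap i mu) + (t + c * (t - 1 - c)) *: E mu.
Proof.
move=> desc; have -> : E (aswap i mu) = hecke_adj t i (E mu) - c *: E mu by rewrite desc addrK.
rewrite linearB linearZ /= [hecke_adj t i (hecke_adj _ _ _)]hecke_quadratic ?lo_hi_neq //.
rewrite -/(hecke_adj t i (E mu)) -!mul_mpolyC !(rmorphB, rmorphD, rmorphM) rmorph1 /=.
by ring.
Qed.

Lemma orbit_span_hecke lam i f : orbit_span lam f -> orbit_span lam (hecke_adj t i f).
Proof.
have [_ _ E_desc E_flat] := E_family.
case=> c ->; rewrite linear_sum; apply: orbit_span_sum => nu nu_lam.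
have swap_lam : rearr (aswap i nu) lam by rewrite rearr_aswap.
rewrite linearZ; apply: orbit_spanZ => /=.
case: (ltngtP (nu (lo_ix i) : nat) (nu (hi_ix i))) => [asc|desc|flat].
- have [|c' /hecke_adj_ascent] := E_desc (aswap i nu) i; first by rewrite descent_aswap.
  rewrite aswapK => ->.
  by apply: orbit_span_lin; [|apply: orbit_spanZ]; apply: orbit_span_mem.
- have [c' ->] := E_desc _ _ desc.
  by apply: orbit_spanD; [|apply: orbit_spanZ]; apply: orbit_span_mem.
- by rewrite E_flat //; apply: orbit_spanZ; apply: orbit_span_mem.
Qed.

Definition hecke_word w f := foldr (hecke_adj t) f w.

Lemma orbit_indicator_partition lam : is_partition lam ->
  orbit_indicator lam (pred1 lam) (E lam).
Proof.
have [_ E_tri _ _] := E_family; have [E_lam E_nu] := E_tri lam.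
move=> part; split=> [|nu nu_lam /=]; first exact/orbit_span_mem/rearr_refl.
have [->//|nu_neq] := eqVneq; apply: E_nu => //.
by rewrite inversions_partition.
Qed.

Lemma orbit_indicator_hecke lam mu i f : ascent i mu ->
  orbit_indicator lam (pred1 (aswap i mu)) f ->
  orbit_indicator lam (pred1 mu) (hecke_adj t i f).
Proof.
rewrite -descent_aswap; set kap := aswap i mu => desc [span coef].
split=> [|nu nu_lam /=]; first exact: orbit_span_hecke.
rewrite (mcoeff_hecke_rearr t (lo_hi_neq i) (orbit_span_dominated span) nu_lam).
rewrite !coef ?rearr_mswapl //= -[mswap _ _ nu]/(aswap i nu) -(inj_eq (can_inj (aswapK i)) nu mu).
have [->|nu_neq] := eqVneq nu kap.
  by rewrite (negPf (aswap_neq desc)) mulr0 addr0 hecke_stay_desc ?mul0r.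
by rewrite mulr0 add0r -/kap; case: eqP => [->|_]; rewrite ?mulr0 // hecke_swap_desc ?mulr1.
Qed.

Lemma hecke_word_indicator lam mu w : is_partition lam -> reduced_word w lam mu ->
  orbit_indicator lam (pred1 mu) (hecke_word w (E lam)).
Proof.
move=> part; elim: w mu => [mu [<- _]|i w IHw mu]; first exact: orbit_indicator_partition.
by move/(reduced_word_cons part)=> [/IHw w_ind asc]; exact: orbit_indicator_hecke.
Qed.

Lemma sum_hecke_word_indicator lam (words : 'X_{1..n} -> seq 'I_n.-1) (P : pred 'X_{1..n}) :
  is_partition lam -> (forall mu, rearr mu lam -> reduced_word (words mu) lam mu) ->
  orbit_indicator lam P
    (\sum_(mu : 'X_{1..n < (mdeg lam).+1} | rearr mu lam && P mu)
       hecke_word (words mu) (E lam)).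
Proof.
move=> part words_red; pose label nu : 'X_{1..n < (mdeg lam).+1} := insubd bm0 nu.
have labelK nu : rearr nu lam -> val (label nu) = nu.
  by move=> nu_lam; rewrite insubdK // -topredE /= (mdeg_rearr nu_lam).
apply: (@orbit_indicator_ext _ ((fun mu => rearr (val mu) lam && P (val mu)) \o label)).
  by move=> nu nu_lam /=; rewrite labelK // nu_lam.
apply: orbit_indicator_sum => mu /andP[/words_red/(hecke_word_indicator part) mu_ind _].
apply: orbit_indicator_ext mu_ind => nu nu_lam.
by rewrite -(inj_eq val_inj) labelK.
Qed.

End OrbitSpan.

(** * Products of linear factors *)

Section LinearProducts.

Variables (R : comNzRingType) (n : nat).
Implicit Types (S T : {set 'I_n}) (c : 'I_n -> R) (f : {mpoly R[n]}) (m k nu : 'X_{1..n}).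

Lemma mcoeffXM k f m :
  ('X_[k] * f)@_m = if (k <= m)%MM then f@_(m - k)%MM else 0.
Proof.
case: ifP => [le_km|not_km]; first by rewrite -{1}(submK le_km) addmC mulrC mcoeffMX.
apply/memN_msupp_eq0; rewrite mulrC (perm_mem (msuppMX _ _)).
by apply: contraFN not_km => /mapP[m' _ ->]; exact: lem_addr.
Qed.

Lemma supp_mesym1 S : supp (mesym1 S) = S.
Proof. by apply/setP=> j; rewrite inE mnmE; case: (j \in S). Qed.

Lemma mesym1_le S nu : (mesym1 S <= nu)%MM = (S \subset supp nu).
Proof.
apply/mnm_lepP/subsetP => [le_S i iS|sub_S i].
  by have := le_S i; rewrite !inE mnmE iS.
by rewrite mnmE; case: (boolP (i \in S)) => // /sub_S; rewrite inE.
Qed.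

Lemma mpolyX_mesym1 S : 'X_[mesym1 S] = \prod_(i in S) 'X_i :> {mpoly R[n]}.
Proof.
rewrite mprodXE; congr 'X_[_]; apply/mnmP=> j; rewrite mnmE mnm_sumE.
have [jS|jS] := boolP (j \in S); last first.
  by rewrite big1 // => i iS; rewrite mnm1E; case: eqP jS => // <-; rewrite iS.
rewrite (bigD1 j) //= mnm1E eqxx big1 ?addn0 // => i /andP[_ /negPf ij].
by rewrite mnm1E ij.
Qed.

Definition linprod S c : {mpoly R[n]} := \prod_(i in S) ('X_i - (c i)%:MP).

Lemma linprodE S c :
  linprod S c = \sum_(T : {set 'I_n} | T \subset S) (\prod_(i in S :\: T) - c i) *: 'X_[mesym1 T].
Proof.
pose F i : {mpoly R[n]} := if i \in S then 'X_i else 0.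
pose G i : {mpoly R[n]} := if i \in S then (- c i)%:MP else 1.
rewrite /linprod big_mkcond (eq_bigr (fun i => F i + G i)) => [|i _]; last first.
  by rewrite /F /G mpolyCN; case: ifP => // _; rewrite add0r.
rewrite bigA_distr (bigID (fun T => T \subset S)) /= addrC big1 ?add0r => [|T /subsetPn[i iT iS]].
  apply: eq_bigr => T /subsetP sub_T.
  rewrite -mul_mpolyC rmorph_prod mpolyX_mesym1 mulrC !(big_mkcond (fun i => i \in _)) -big_split.
  apply: eq_bigr => i _ /=; rewrite inE /F /G.
  by case: (boolP (i \in T)) => [/sub_T->|]; rewrite ?mulr1 ?mul1r.
by rewrite (bigD1 i) //= iT /F (negPf iS) mul0r.
Qed.

Lemma mcoeff_linprodM S c f m : (linprod S c * f)@_m =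
  \sum_(T : {set 'I_n} | (T \subset S) && (mesym1 T <= m)%MM)
     (\prod_(i in S :\: T) - c i) * f@_(m - mesym1 T)%MM.
Proof.
rewrite linprodE mulr_suml raddf_sum big_mkcondr; apply: eq_bigr => T _ /=.
by rewrite -scalerAl mcoeffZ mcoeffXM; case: ifP; rewrite ?mulr0.
Qed.

Lemma linprodM_supp S c f m : (linprod S c * f)@_m != 0 ->
  exists2 m', f@_m' != 0 & forall i, (m i <= m' i + (i \in S))%N.
Proof.
rewrite mcoeff_linprodM => nz.
have /existsP[T /andP[sub_T nz_T]] :
    [exists T : {set 'I_n}, (T \subset S) && (f@_(m - mesym1 T)%MM != 0)].
  apply: contraR nz => /existsPn T0; rewrite big1 // => T /andP[sub_T _].
  by have := T0 T; rewrite sub_T negbK => /eqP->; rewrite mulr0.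
exists (m - mesym1 T)%MM => // i; rewrite mnmBE mnmE.
by have /implyP := subsetP sub_T i; case: (i \in T); case: (i \in S) => //=; lia.
Qed.

Lemma mcoeff_linprodM_top S c f d nu : (forall m, f@_m != 0 -> (mdeg m <= d)%N) ->
  mdeg nu = (d + #|S|)%N ->
  (linprod S c * f)@_nu = if S \subset supp nu then f@_(nu - mesym1 S)%MM else 0.
Proof.
move=> f_deg nu_deg; rewrite mcoeff_linprodM -mesym1_le.
have low T : T \subset S -> T != S -> (mesym1 T <= nu)%MM -> f@_(nu - mesym1 T)%MM = 0.
  move=> sub_T neq_T le_T; apply/eqP/negPn/negP => /f_deg.
  have := congr1 (@mdeg n) (submK le_T); rewrite mdegD mdeg_mesym1 nu_deg => degE.
  by have := proper_card (_ : T \proper S); rewrite properEneq neq_T sub_T => /(_ isT); lia.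
case: ifP => [le_S|not_S]; last first.
  rewrite big1 // => T /andP[sub_T le_T]; rewrite low ?mulr0 //.
  by apply: contraFneq not_S => <-.
rewrite (bigD1 S) ?subxx ?le_S //= setDv big_set0 mul1r big1 ?addr0 //.
by move=> T /andP[/andP[sub_T le_T] neq_T]; rewrite low ?mulr0.
Qed.

End LinearProducts.

(** * Removing the first column *)

Section FirstColumn.

Variable n : nat.
Implicit Types (lam mu nu m : 'X_{1..n}) (S : {set 'I_n}) (s : 'S_n).

Definition strip_column lam : 'X_{1..n} := [multinom (lam i).-1 | i < n].

Lemma conjp1 lam : conjp lam 1 = #|supp lam|.
Proof. by []. Qed.

Lemma subm_mesym1_supp lam : (lam - mesym1 (supp lam))%MM = strip_column lam.
Proof. by apply/mnmP=> i; rewrite mnmBE !mnmE inE; lia. Qed.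

Lemma strip_column_partition lam : is_partition lam -> is_partition (strip_column lam).
Proof. by move/partitionP=> dec; apply/partitionP=> i j /dec; rewrite !mnmE; lia. Qed.

Lemma rearr_strip_column nu lam :
  rearr nu lam -> rearr (strip_column nu) (strip_column lam).
Proof.
by case/rearrP=> s ->; apply/rearrP; exists s; apply/mnmP=> j; rewrite !mnmE.
Qed.

Lemma mdeg_strip_column lam : mdeg lam = (mdeg (strip_column lam) + conjp lam 1)%N.
Proof.
rewrite conjp1 -mdeg_mesym1 -mdegD -subm_mesym1_supp.
by rewrite submK // mesym1_le.
Qed.

Lemma conjp_strip_column lam c : conjp (strip_column lam) c.+1 = conjp lam c.+2.
Proof. by apply: eq_card => j; rewrite !inE mnmE; lia. Qed.

Lemma part1_strip_column lam : part1 (strip_column lam) = (part1 lam).-1.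
Proof.
rewrite /part1; case: (posnP n) => [n0|n_gt0]; first by rewrite !nth_default // size_tuple n0.
by rewrite -!(mnm_nth 0%N _ (Ordinal n_gt0)) mnmE.
Qed.

Lemma prod_conjp_strip_column (R : comNzRingType) lam (F : nat -> R) :
  \prod_(1 <= c < (part1 (strip_column lam)).+1) F (conjp (strip_column lam) c)
  = \prod_(2 <= c < (part1 lam).+1) F (conjp lam c).
Proof.
rewrite part1_strip_column; case: (part1 lam) => [|d]; first by rewrite !big_geq.
rewrite [RHS]big_add1 /= big_nat_cond [RHS]big_nat_cond.
by apply: eq_bigr => -[|c] //= _; rewrite conjp_strip_column.
Qed.

Lemma part1_eq0 lam : is_partition lam -> part1 lam = 0%N -> lam = 0%MM.
Proof.
move/partitionP=> dec part1_0; apply/mnmP=> j; rewrite mnm0E.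
have n_gt0 : (0 < n)%N by apply: leq_ltn_trans (ltn_ord j).
have := dec (Ordinal n_gt0) j; rewrite (mnm_nth 0%N lam (Ordinal n_gt0)) /=.
by rewrite -/(part1 lam) part1_0 leqn0 => /(_ isT)/eqP.
Qed.

Lemma dominates_add_column lam m m' S :
  dominates (strip_column lam) m' -> (#|S| <= conjp lam 1)%N ->
  (forall i, (m i <= m' i + (i \in S))%N) -> dominates lam m.
Proof.
move=> dom le_S le_m [|c].
  rewrite !sum_subn0 (mdeg_strip_column lam); apply: leq_trans (leq_add (dominates_mdeg dom) le_S).
  by rewrite -mdeg_mesym1 -mdegD !mdegE; apply: leq_sum => i _; rewrite mnmDE mnmE.
apply: leq_trans (_ : \sum_j (strip_column lam j - c) <= _)%N; last first.
  by apply: leq_sum => i _; rewrite mnmE; lia.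
by apply: leq_trans (dom c); apply: leq_sum => i _; have := le_m i; case: (i \in S) => /=; lia.
Qed.

Lemma supp_rearr_eq S nu lam : rearr nu lam -> #|S| = conjp lam 1 ->
  S \subset supp nu -> supp nu = S.
Proof.
move=> /(conjp_rearr 1) card_nu cardS sub_S; apply/esym/eqP.
by rewrite eqEcard sub_S -conjp1 card_nu cardS leqnn.
Qed.

Lemma mcoeff_linprodM_column (R : comNzRingType) S (c : 'I_n -> R) (A : {mpoly R[n]}) lam nu :
  #|S| = conjp lam 1 -> rearr nu lam ->
  (forall m, A@_m != 0 -> (mdeg m <= mdeg (strip_column lam))%N) ->
  (linprod S c * A)@_nu = if supp nu == S then A@_(strip_column nu) else 0.
Proof.
move=> cardS nu_lam A_deg; rewrite (mcoeff_linprodM_top _ A_deg); last first.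
  by rewrite (mdeg_rearr nu_lam) cardS -mdeg_strip_column.
have [<-|nu_supp] := eqVneq (supp nu) S; first by rewrite subxx subm_mesym1_supp.
by rewrite ifN //; apply: contra nu_supp => /(supp_rearr_eq nu_lam cardS)->.
Qed.

Definition front k : {set 'I_n} := [set i : 'I_n | (i < k)%N].

Lemma card_front k : (k <= n)%N -> #|front k| = k.
Proof.
by move=> le_kn; rewrite -sum1dep_card -(big_ord_widen n (fun=> 1%N) le_kn) sum1_card card_ord.
Qed.

Lemma conjp_le lam c : (conjp lam c <= n)%N.
Proof. by rewrite -[leqRHS]card_ord; exact: max_card. Qed.

Lemma supp_partition lam : is_partition lam -> supp lam = front (conjp lam 1).
Proof.
move/partitionP=> dec; apply/setP=> i; rewrite !inE; apply/idP/idP => lam_i.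
  rewrite -[X in (X <= _)%N](card_front (ltn_ord i)); apply: subset_leq_card.
  by apply/subsetP=> j; rewrite !inE ltnS => /dec; lia.
apply: contraLR lam_i; rewrite -leqNgt leqn0 -leqNgt => /eqP lam_i.
rewrite -[leqRHS](card_front (ltnW (ltn_ord i))); apply: subset_leq_card.
apply/subsetP=> j; rewrite !inE => pos_j.
by rewrite ltnNge; apply/negP => /dec; lia.
Qed.

End FirstColumn.

(** * Rotation of the variables *)

Section Rotation.

Variables (n k : nat).
Hypothesis le_kn : (k <= n)%N.
Implicit Types (i j l : 'I_n) (lam mu nu : 'X_{1..n}).

Let ord_rot_subproof j : ((j + k) %% n < n)%N.
Proof. by rewrite ltn_mod; exact: leq_ltn_trans (ltn_ord j). Qed.

Definition ord_rot j : 'I_n := Ordinal (ord_rot_subproof j).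

Lemma ord_rot_inj : injective ord_rot.
Proof.
move=> i j [/eqP]; rewrite eqn_modDr !modn_small ?ltn_ord // => /eqP.
exact: ord_inj.
Qed.

Definition rotation : 'S_n := perm ord_rot_inj.

Lemma rotationE j :
  rotation j = (if (j + k < n)%N then j + k else j + k - n)%N :> nat.
Proof.
rewrite permE /=; case: ltnP => [/modn_small//|le_n].
rewrite -{1}(subnK le_n) modnDr modn_small //; have := ltn_ord j; lia.
Qed.

Lemma rotation_front j : (rotation j \in front n k) = (n - k <= j)%N.
Proof. by rewrite inE rotationE; have := ltn_ord j; case: (ltnP (j + k) n); lia. Qed.

Definition unraise nu : 'X_{1..n} := (nu - mesym1 (front n k))%MM # rotation.

Lemma unraise_strip_column nu : supp nu = front n k -> unraise nu = strip_column nu # rotation.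
Proof. by move=> nu_supp; rewrite /unraise -nu_supp subm_mesym1_supp. Qed.

Lemma kidx_unraise nu j : front n k \subset supp nu ->
  kidx (unraise nu) j = kidx nu (rotation j).
Proof.
move=> /subsetP pos; apply: kidx_reindex => l i; rewrite /outranks !mnmE.
have := pos (rotation l); have := pos (rotation i); rewrite !inE !rotationE.
have := ltn_ord l; have := ltn_ord i.
by case: (ltnP (l + k) n) => ?; case: (ltnP (i + k) n) => ?; lia.
Qed.

Lemma mdeg_unraise nu : front n k \subset supp nu -> mdeg nu = (mdeg (unraise nu) + k)%N.
Proof.
move=> pos; rewrite /unraise mdeg_mperm -[X in (_ + X)%N](card_front le_kn) -mdeg_mesym1.
by rewrite -mdegD submK // mesym1_le.
Qed.

Lemma unraise_inj nu lam : front n k \subset supp nu -> front n k \subset supp lam ->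
  unraise nu = unraise lam -> nu = lam.
Proof.
rewrite -!mesym1_le => nu_pos lam_pos /mperm_inj eq_nu.
by rewrite -(submK nu_pos) eq_nu submK.
Qed.

Lemma rearr_unraise nu lam : supp nu = front n k -> supp lam = front n k ->
  rearr nu lam -> rearr (unraise nu) (unraise lam).
Proof.
move=> nu_supp lam_supp /rearr_strip_column nu_lam; rewrite !unraise_strip_column //.
apply: rearr_trans (rearr_mperm _ _) (rearr_trans nu_lam _).
by rewrite rearr_sym rearr_mperm.
Qed.

(* The [n - k] zero parts of [nu] move from the back to the front, where each of them forms an
   inversion with each positive part of [unraise nu]. *)
Lemma inversions_unraise nu : supp nu = front n k ->
  inversions (unraise nu) = (inversions nu + (n - k) * conjp (unraise nu) 1)%N.
Proof.
move=> nu_supp; have pos i : (0 < nu i)%N = (i < k)%N.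
  by have /setP/(_ i) := nu_supp; rewrite !inE.
pose f (p : 'I_n * 'I_n) := (rotation p.1, rotation p.2).
have fI : injective f by move=> [x y] [x' y'] [/perm_inj-> /perm_inj->].
pose B := f @^-1: [set p : 'I_n * 'I_n | (p.1 < p.2)%N && (nu p.1 < nu p.2)%N].
pose C := setX (front n (n - k)) (supp (unraise nu)).
have -> : inversions nu = #|B| by rewrite card_preimset.
rewrite -{1}(card_front (leq_subr k n)) conjp1 -cardsX.
have disjoint_BC : B :&: C = set0.
  apply/setP=> -[x y]; rewrite !inE /= !mnmE.
  have := pos (rotation x); have := pos (rotation y).
  rewrite inE !rotationE; have := ltn_ord x; have := ltn_ord y.
  by case: (ltnP (x + k)); case: (ltnP (y + k)); lia.
rewrite -/C -cardsUI disjoint_BC cards0 addn0.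
apply: eq_card => -[x y]; rewrite !inE /= !mnmE.
have := pos (rotation x); have := pos (rotation y).
rewrite !inE !rotationE; have := ltn_ord x; have := ltn_ord y.
by case: (ltnP (x + k)); case: (ltnP (y + k)); lia.
Qed.

End Rotation.

(** * Specialization at q = 1 *)

HB.instance Definition _ := GRing.isZmodMorphism.Build {poly {poly rat}} Kqt frac_qt
  (@tofrac_is_zmod_morphism {poly {poly rat}}).
HB.instance Definition _ := GRing.isMonoidMorphism.Build {poly {poly rat}} Kqt frac_qt
  (@tofrac_is_monoid_morphism {poly {poly rat}}).
HB.instance Definition _ := GRing.isZmodMorphism.Build {poly rat} Kt frac_t
  (@tofrac_is_zmod_morphism {poly rat}).
HB.instance Definition _ := GRing.isMonoidMorphism.Build {poly rat} Kt frac_t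
  (@tofrac_is_monoid_morphism {poly rat}).

Section Specialization.

Implicit Types (a b : {poly {poly rat}}) (f : Kqt) (g : Kt).

Lemma frac_qt_inj : injective frac_qt.
Proof. by move=> a b /eqP; rewrite tofrac_eq => /eqP. Qed.

Lemma frac_t_inj : injective frac_t.
Proof. by move=> a b /eqP; rewrite tofrac_eq => /eqP. Qed.

Lemma frac_qt_eq0 a : (frac_qt a == 0) = (a == 0).
Proof. exact: tofrac_eq0. Qed.

Lemma frac_t_eq0 (a : {poly rat}) : (frac_t a == 0) = (a == 0).
Proof. exact: tofrac_eq0. Qed.

Lemma frac_qt_horner1_neq0 b : b.[1] != 0 -> frac_qt b != 0.
Proof. by rewrite frac_qt_eq0; apply: contraNneq => ->; rewrite horner0. Qed.

Lemma spec1_uniq f g g' : spec1 f g -> spec1 f g' -> g = g'.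
Proof.
case=> a [b [b1 -> ->]] [a' [b' [b'1 /eqP eq_f ->]]].
move: eq_f; rewrite eqr_div ?frac_qt_horner1_neq0 // -!rmorphM => /eqP/frac_qt_inj eq_ab.
by apply/eqP; rewrite eqr_div ?frac_t_eq0 // -!rmorphM -!hornerM eq_ab.
Qed.

Lemma spec1_frac a : spec1 (frac_qt a) (frac_t a.[1]).
Proof. by exists a, 1; rewrite hornerC oner_eq0 !rmorph1 !divr1. Qed.

Lemma spec1_0 : spec1 0 0.
Proof. by have := spec1_frac 0; rewrite horner0 !rmorph0. Qed.

Lemma spec1_1 : spec1 1 1.
Proof. by have := spec1_frac 1; rewrite hornerC !rmorph1. Qed.

Lemma spec1_q : spec1 qK 1.
Proof. by have := spec1_frac 'X; rewrite hornerX rmorph1. Qed.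

Lemma spec1_t : spec1 tK tQ.
Proof. by have := spec1_frac ('X)%:P; rewrite hornerC. Qed.

Lemma spec1D f f' g g' : spec1 f g -> spec1 f' g' -> spec1 (f + f') (g + g').
Proof.
case=> a [b [b1 -> ->]] [a' [b' [b'1 -> ->]]]; exists (a * b' + a' * b), (b * b').
rewrite hornerM mulf_neq0 // !addf_div ?frac_qt_horner1_neq0 ?frac_t_eq0 //.
by rewrite hornerD !hornerM !rmorphD !rmorphM.
Qed.

Lemma spec1M f f' g g' : spec1 f g -> spec1 f' g' -> spec1 (f * f') (g * g').
Proof.
case=> a [b [b1 -> ->]] [a' [b' [b'1 -> ->]]]; exists (a * a'), (b * b').
by rewrite hornerM mulf_neq0 // !mulf_div !hornerM !rmorphM.
Qed.

Lemma spec1N f g : spec1 f g -> spec1 (- f) (- g).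
Proof.
case=> a [b [b1 -> ->]]; exists (- a), b.
by rewrite hornerN !rmorphN !mulNr.
Qed.

Lemma spec1B f f' g g' : spec1 f g -> spec1 f' g' -> spec1 (f - f') (g - g').
Proof. by move=> fg f'g'; apply/spec1D/spec1N. Qed.

Lemma spec1V f g : spec1 f g -> g != 0 -> spec1 f^-1 g^-1.
Proof.
case=> a [b [b1 -> ->]] nz; exists b, a; rewrite !invf_div; split=> //.
by apply: contraNneq nz => ->; rewrite rmorph0 mul0r.
Qed.

Lemma spec1X f g k : spec1 f g -> spec1 (f ^+ k) (g ^+ k).
Proof. by move=> fg; elim: k => [|k IHk]; [exact: spec1_1|rewrite !exprS; exact: spec1M]. Qed.

Lemma qt_monomial_inj i j k l :
  qK ^+ i * tK ^+ j = qK ^+ k * tK ^+ l -> i = k /\ j = l.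
Proof.
rewrite /qK /tK -!rmorphXn -!rmorphM /= => /frac_qt_inj eq_ij.
have coefE r : ('X^i * ('X^j)%:P : {poly {poly rat}})`_r
               = ('X^k * ('X^l)%:P : {poly {poly rat}})`_r by rewrite eq_ij.
move: (coefE i); rewrite !coefMC !coefXn eqxx mul1r; case: eqP => [->|_].
  by rewrite mul1r => /(congr1 (size \o polyseq)); rewrite /= !size_polyXn => -[].
by rewrite mul0r => /eqP; rewrite -size_poly_eq0 size_polyXn.
Qed.

Lemma qK_neq0 : qK != 0.
Proof. by rewrite frac_qt_eq0 polyX_eq0. Qed.

Lemma tK_neq0 : tK != 0.
Proof. by rewrite frac_qt_eq0 polyC_eq0 polyX_eq0. Qed.

Lemma tQ_neq0 : tQ != 0.
Proof. by rewrite frac_t_eq0 polyX_eq0. Qed.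

Lemma tQ_expI : injective (fun k => tQ ^+ k).
Proof.
move=> i j; rewrite /= /tQ -!rmorphXn => /frac_t_inj.
by move/(congr1 (size \o polyseq)); rewrite /= !size_polyXn => -[].
Qed.

Lemma tQ_neq1 : tQ != 1.
Proof. by apply/eqP; rewrite -[tQ]expr1 -(expr0 tQ) => /tQ_expI. Qed.

End Specialization.

Section PolySpecialization.

Variable n : nat.
Implicit Types (f : {mpoly Kqt[n]}) (g : {mpoly Kt[n]}).

Lemma mspec1_uniq f g g' : mspec1 f g -> mspec1 f g' -> g = g'.
Proof. by move=> fg fg'; apply/mpolyP=> m; apply: spec1_uniq (fg m) (fg' m). Qed.

Lemma mspec1_0 : @mspec1 n 0 0.
Proof. by move=> m; rewrite !mcoeff0; exact: spec1_0. Qed.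

Lemma mspec1D f f' g g' : mspec1 f g -> mspec1 f' g' -> mspec1 (f + f') (g + g').
Proof. by move=> fg f'g' m; rewrite !mcoeffD; apply: spec1D. Qed.

Lemma mspec1Z c d f g : spec1 c d -> mspec1 f g -> mspec1 (c *: f) (d *: g).
Proof. by move=> cd fg m; rewrite !mcoeffZ; apply: spec1M. Qed.

Lemma mspec1B f f' g g' : mspec1 f g -> mspec1 f' g' -> mspec1 (f - f') (g - g').
Proof. by move=> fg f'g' m; rewrite !mcoeffB; apply: spec1B. Qed.

Lemma mspec1_sum (I : Type) (r : seq I) (P : pred I)
    (F : I -> {mpoly Kqt[n]}) (G : I -> {mpoly Kt[n]}) :
  (forall i, P i -> mspec1 (F i) (G i)) ->
  mspec1 (\sum_(i <- r | P i) F i) (\sum_(i <- r | P i) G i).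
Proof.
by move=> FG; apply: (big_ind2 (@mspec1 n)) => //; [exact: mspec1_0|move=> *; exact: mspec1D].
Qed.

Lemma mspec1_X (m : 'X_{1..n}) : mspec1 'X_[m] 'X_[m].
Proof. by move=> k; rewrite !mcoeffX; case: eqP => _; [exact: spec1_1|exact: spec1_0]. Qed.

Lemma mspec1_1 : @mspec1 n 1 1.
Proof. by rewrite -!mpolyX0; exact: mspec1_X. Qed.

Lemma mspec1_C c d : spec1 c d -> @mspec1 n c%:MP d%:MP.
Proof.
by move=> cd; rewrite -[c%:MP]mulr1 -[d%:MP]mulr1 !mul_mpolyC; apply: mspec1Z cd mspec1_1.
Qed.

Lemma mspec1M f f' g g' : mspec1 f g -> mspec1 f' g' -> mspec1 (f * f') (g * g').
Proof.
move=> fg f'g' m; rewrite !mcoeffM; apply: (big_ind2 spec1); first exact: spec1_0.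
  by move=> *; exact: spec1D.
by move=> k _; apply: spec1M.
Qed.

Lemma mspec1_prod (I : Type) (r : seq I) (P : pred I)
    (F : I -> {mpoly Kqt[n]}) (G : I -> {mpoly Kt[n]}) :
  (forall i, P i -> mspec1 (F i) (G i)) ->
  mspec1 (\prod_(i <- r | P i) F i) (\prod_(i <- r | P i) G i).
Proof.
by move=> FG; apply: (big_ind2 (@mspec1 n)) => //; [exact: mspec1_1|move=> *; exact: mspec1M].
Qed.

Lemma mspec1_linprod (S : {set 'I_n}) (c : 'I_n -> Kqt) (d : 'I_n -> Kt) :
  (forall i, spec1 (c i) (d i)) -> mspec1 (linprod S c) (linprod S d).
Proof.
by move=> cd; apply: mspec1_prod => i _; apply: mspec1B; [exact: mspec1_X|exact: mspec1_C].
Qed.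

Lemma mspec1_msym (s : 'S_n) f g : mspec1 f g -> mspec1 (msym s f) (msym s g).
Proof. by move=> fg m; rewrite !mcoeff_sym. Qed.

Lemma mspec1_mlift (F : 'X_{1..n} -> {mpoly Kqt[n]}) (G : 'X_{1..n} -> {mpoly Kt[n]}) f g :
  (forall m, mspec1 (F m) (G m)) -> mspec1 f g -> mspec1 (mlift F f) (mlift G g).
Proof.
move=> FG fg; rewrite (mliftwE F (leq_maxl (msize f) (msize g))).
rewrite (mliftwE G (leq_maxr (msize f) (msize g))).
by apply: mspec1_sum => m _; apply: mspec1Z.
Qed.

Lemma mspec1_hecke a b f g : mspec1 f g -> mspec1 (hecke tK a b f) (hecke tQ a b g).
Proof.
have t1 : spec1 (tK - 1) (tQ - 1) by apply/spec1B; [exact: spec1_t|exact: spec1_1].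
have t1' : spec1 (1 - tK) (1 - tQ) by apply/spec1B; [exact: spec1_1|exact: spec1_t].
apply: mspec1_mlift => m; apply: mspec1D; first apply: mspec1D.
- apply: mspec1Z (mspec1_X _); rewrite /hecke_stay; case: ifP => _; first exact: spec1_t.
  by case: ifP => _ //; exact: spec1_0.
- apply: mspec1Z (mspec1_X _); rewrite /hecke_swap; case: ifP => _; first exact: spec1_0.
  by case: ifP => _; [exact: spec1_1|exact: spec1_t].
- apply: mspec1Z; first by rewrite /hecke_between; case: ifP.
  by apply: mspec1_sum => j _; exact: mspec1_X.
Qed.

Lemma HeckeE i f : Hecke i f = hecke_adj tK i f.
Proof.
have lo_hi := lo_hi_neq i; apply/esym; apply: heckeP => //.
have := epsilon_spec (inhabits 0) _ (dvd_msymB f lo_hi).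
rewrite -/(sadj i) -/(spoly i f) -/(ddiff i f) => ddiffE.
rewrite /Hecke -!mul_mpolyC mulrBr [_ * (_ * ddiff i f)]mulrCA ddiffE rmorphB rmorph1 /=.
by ring.
Qed.

End PolySpecialization.

(** * Raising operators *)

Section Raising.

Variables (K : fieldType) (n k : nat) (q c : K).
Hypotheses (le_kn : (k <= n)%N) (q_neq0 : q != 0).
Implicit Types (lam mu nu m : 'X_{1..n}) (p : {mpoly K[n]}).

Definition qscale p : {mpoly K[n]} :=
  mlift (fun m => q ^- (\sum_(i in front n k) m i) *: 'X_[m]) p.

Lemma mcoeff_qscale p m : (qscale p)@_m = p@_m / q ^+ (\sum_(i in front n k) m i).
Proof. exact: mcoeff_mlift_diag. Qed.

Lemma meval_qscale p (v : 'I_n -> K) :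
  (qscale p).@[v] = p.@[fun i => v i / q ^+ (i \in front n k)].
Proof.
rewrite [RHS]mevalE /qscale raddf_sum /=; apply: eq_bigr => m _.
rewrite !mevalZ mevalX expr_sum big_mkcond -prodfV -big_split; congr (_ * _).
apply: eq_bigr => i _; rewrite exprMn exprVn mulrC; congr (_ * _); congr _^-1.
by case: ifP => _; rewrite ?expr1n ?expr1.
Qed.

(* The scalar [q ^+ d], where [d] is the degree of [p], normalizes the top coefficients. *)
Definition raise (d : nat) p : {mpoly K[n]} :=
  q ^+ d *: (linprod (front n k) (fun=> c) * qscale (msym (rotation n k) p)).

Lemma supp_dominated_raise lam d p : supp lam = front n k ->
  supp_dominated (unraise k lam) p -> supp_dominated lam (raise d p).
Proof.
move=> lam_supp dom m; rewrite mcoeffZ mulf_eq0 negb_or => /andP[_ /linprodM_supp[m' nz le_m]].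
apply: dominates_add_column le_m; last by rewrite -lam_supp.
move: nz; rewrite mcoeff_qscale mulf_eq0 negb_or mcoeff_sym => /andP[/dom + _].
rewrite unraise_strip_column // => dom'.
exact: dominates_rearrl (rearr_mperm _ _) (dominates_rearrr (rearr_mperm _ _) dom').
Qed.

Lemma mcoeff_raise nu d p :
  (forall m, p@_m != 0 -> (mdeg m <= d)%N) -> mdeg nu = (d + k)%N ->
  (raise d p)@_nu = if front n k \subset supp nu
    then q ^+ d * (p@_(unraise k nu)
                   / q ^+ (\sum_(i in front n k) (nu - mesym1 (front n k))%MM i))
    else 0.
Proof.
move=> p_deg nu_deg; rewrite mcoeffZ (@mcoeff_linprodM_top _ _ _ _ _ d) ?card_front //.
  by rewrite mcoeff_qscale mcoeff_sym; case: ifP; rewrite ?mulr0.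
move=> m; rewrite mcoeff_qscale mulf_eq0 negb_or mcoeff_sym => /andP[/p_deg + _].
by rewrite mdeg_mperm.
Qed.

Lemma unitriangular_raise lam p : supp lam = front n k ->
  supp_dominated (unraise k lam) p -> unitriangular (unraise k lam) p ->
  unitriangular lam (raise (mdeg (strip_column lam)) p).
Proof.
move=> lam_supp dom [p_lam p_nu]; set d := mdeg (strip_column lam).
have dE : mdeg (unraise k lam) = d by rewrite unraise_strip_column // mdeg_mperm.
have lam_deg : mdeg lam = (d + k)%N by rewrite (@mdeg_unraise _ k) ?lam_supp // dE.
have p_deg m : p@_m != 0 -> (mdeg m <= d)%N by rewrite -dE => /dom/dominates_mdeg.
split=> [|nu nu_lam le_nu nu_neq]; rewrite mcoeff_raise //; last first.
- by rewrite (mdeg_rearr nu_lam).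
- case: ifP => // pos; have nu_supp : supp nu = front n k.
    apply: supp_rearr_eq nu_lam _ pos.
    by rewrite conjp1 lam_supp.
  have unraise_nu := rearr_unraise nu_supp lam_supp nu_lam.
  rewrite p_nu ?mul0r ?mulr0 //.
    by rewrite !inversions_unraise // (conjp_rearr _ unraise_nu) leq_add2r.
  by apply: contra nu_neq => /eqP/unraise_inj->; rewrite ?nu_supp ?lam_supp.
rewrite lam_supp subxx p_lam mul1r -lam_supp subm_mesym1_supp.
suff -> : (\sum_(i in supp lam) strip_column lam i)%N = d by rewrite mulfV ?expf_neq0.
rewrite /d mdegE big_mkcond; apply: eq_bigr => i _.
by rewrite inE mnmE; case: (lam i).
Qed.

End Raising.

(** * Unisolvence of triangular interpolation problems *)

Section Unisolvence.

Variables (K : fieldType) (n : nat).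
Variables (x : 'X_{1..n} -> 'I_n -> K) (E : 'X_{1..n} -> {mpoly K[n]}).
Hypothesis E_size : forall mu, (msize (E mu) <= (mdeg mu).+1)%N.
Hypothesis E_node : forall mu, (E mu).@[x mu] != 0.
Hypothesis E_vanish : forall mu nu, (mdeg nu <= mdeg mu)%N -> nu != mu -> (E mu).@[x nu] = 0.
Implicit Types (mu nu : 'X_{1..n}) (f g : {mpoly K[n]}) (d : nat).

Lemma interpolation_exists d (v : 'X_{1..n} -> K) :
  exists2 f, (msize f <= d)%N & forall nu, (mdeg nu < d)%N -> f.@[x nu] = v nu.
Proof.
elim: d => [|d [f f_size f_val]]; first by exists 0; rewrite ?msize0.
pose c mu := (v mu - f.@[x mu]) / (E mu).@[x mu].
exists (f + \sum_(mu : 'X_{1..n < d.+1} | mdeg mu == d) c mu *: E mu).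
  apply: leq_trans (mmeasureD_le _ _ _) _; rewrite geq_max (leqW f_size) /=.
  apply: leq_trans (mmeasure_sum _ _ _ _) _; apply/bigmax_leqP => mu /eqP mu_deg.
  by apply: leq_trans (msizeZ_le _ _) _; have := E_size mu; rewrite mu_deg.
move=> nu lt_nu; rewrite mevalD raddf_sum /=; have [nu_deg|nu_deg] := eqVneq (mdeg nu) d.
  rewrite (bigD1 (BMultinom lt_nu)) /= ?nu_deg // big1 ?addr0 => [|mu /andP[/eqP mu_deg]].
    by rewrite mevalZ /c divfK // addrC subrK.
  rewrite -(inj_eq val_inj) /= mevalZ => mu_neq.
  by rewrite E_vanish ?mulr0 // ?nu_deg ?mu_deg // eq_sym.
rewrite f_val; last by rewrite ltn_neqAle nu_deg -ltnS.
rewrite big1 ?addr0 // => mu /eqP mu_deg; rewrite mevalZ E_vanish ?mulr0 //.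
  by rewrite mu_deg -ltnS.
by apply: contraNneq nu_deg => ->; rewrite mu_deg.
Qed.

Definition coef_row d f : 'rV[K]_#|{: 'X_{1..n < d}}| :=
  \row_r f@_(enum_val r : 'X_{1..n < d}).

Definition eval_mx d : 'M[K]_#|{: 'X_{1..n < d}}| :=
  \matrix_(r, s) \prod_i x (enum_val s : 'X_{1..n < d}) i ^+ (enum_val r : 'X_{1..n < d}) i.

Lemma coef_row_eval_mx d f : (msize f <= d)%N ->
  coef_row d f *m eval_mx d = \row_s f.@[x (enum_val s : 'X_{1..n < d})].
Proof.
move=> f_size; apply/rowP=> s; rewrite !mxE {2}(mpolywE f_size) raddf_sum /=.
rewrite (big_enum_val (fun m : 'X_{1..n < d} => meval _ (f@_m *: 'X_[m]))) /=.
by apply: eq_bigr => r _; rewrite !mxE mevalZ mevalX.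
Qed.

Lemma eval_mx_unit d : eval_mx d \in unitmx.
Proof.
rewrite -row_full_unit -sub1mx; apply/row_subP=> s; apply/submxP.
have [f f_size f_val] := interpolation_exists d (fun nu => (nu == (enum_val s : 'X_{1..n < d}))%:R).
exists (coef_row d f); rewrite coef_row_eval_mx //; apply/rowP=> r.
by rewrite !mxE f_val ?bmdeg // (inj_eq val_inj) (inj_eq enum_val_inj) eq_sym.
Qed.

Lemma interpolation_eq0 d f : (msize f <= d)%N ->
  (forall nu, (mdeg nu < d)%N -> f.@[x nu] = 0) -> f = 0.
Proof.
move=> f_size f0; have row0 : coef_row d f = 0.
  apply: (can_inj (mulmxK (eval_mx_unit d))); rewrite mul0mx coef_row_eval_mx //.
  by apply/rowP=> s; rewrite !mxE f0 // bmdeg.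
apply/mpolyP=> m; rewrite mcoeff0; case: (ltnP (mdeg m) d) => lt_m.
  have /rowP/(_ (enum_rank (BMultinom lt_m))) := row0.
  by rewrite !mxE enum_rankK.
by apply/memN_msupp_eq0/msize_mdeg_ge; apply: leq_trans f_size lt_m.
Qed.

Lemma interpolation_uniq d m (u : 'X_{1..n} -> K) (cf cg : K) f g :
  (msize f <= d)%N -> (msize g <= d)%N -> f@_m = 1 -> g@_m = 1 ->
  (forall nu, (mdeg nu < d)%N -> f.@[x nu] = cf * u nu) ->
  (forall nu, (mdeg nu < d)%N -> g.@[x nu] = cg * u nu) -> f = g.
Proof.
move=> f_size g_size f_m g_m f_val g_val.
have comb_size a b : (msize (a *: f - b *: g) <= d)%N.
  apply: leq_trans (mmeasureD_le _ _ _) _; rewrite geq_max mmeasureN.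
  by rewrite !(leq_trans (msizeZ_le _ _)).
have comb0 : cg *: f - cf *: g = 0.
  apply: interpolation_eq0 (comb_size _ _) _ => nu lt_nu.
  by rewrite mevalB !mevalZ f_val // g_val // mulrCA subrr.
have eq_c : cg = cf.
  have := congr1 (mcoeff m) comb0; rewrite mcoeffB !mcoeffZ mcoeff0 f_m g_m !mulr1.
  exact: subr0_eq.
have := comb_size 1 1; rewrite !scale1r => fg_size.
apply: subr0_eq; apply: interpolation_eq0 fg_size _ => nu lt_nu.
by rewrite mevalB f_val // g_val // eq_c subrr.
Qed.

End Unisolvence.

(** * Interpolation polynomials *)

Section Intertwiners.

Variables (K : fieldType) (n : nat) (t : K).
Implicit Types (i : 'I_n.-1) (p : {mpoly K[n]}) (v : 'I_n -> K).

Definition intertwiner_coef v i : K :=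
  (1 - t) * v (hi_ix i) / (v (lo_ix i) - v (hi_ix i)).

Lemma meval_hecke_adj p v i : v (lo_ix i) != v (hi_ix i) ->
  (hecke_adj t i p).@[v] = intertwiner_coef v i * p.@[v]
    + (t * v (lo_ix i) - v (hi_ix i)) / (v (lo_ix i) - v (hi_ix i)) * p.@[v \o sadj i].
Proof.
rewrite -subr_eq0 => v_neq; apply: (mulfI v_neq); rewrite (meval_hecke t p v (lo_hi_neq i)).
by rewrite /intertwiner_coef; field.
Qed.

Lemma meval_hecke_adj_flat p v i : v (lo_ix i) != v (hi_ix i) ->
  t * v (lo_ix i) = v (hi_ix i) -> (hecke_adj t i p).@[v] = t * p.@[v].
Proof.
move=> v_neq flat; rewrite meval_hecke_adj // /intertwiner_coef flat subrr mul0r mul0r addr0.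
rewrite -subr_eq0 in v_neq; rewrite -flat in v_neq *.
by field.
Qed.

Lemma intertwiner_coef_eqN1 v i : t != 1 -> v (hi_ix i) != 0 ->
  v (lo_ix i) = t * v (hi_ix i) -> intertwiner_coef v i = -1.
Proof.
rewrite -subr_eq0 => t_neq1 v_neq0 vE; rewrite /intertwiner_coef vE.
have -> : t * v (hi_ix i) - v (hi_ix i) = (t - 1) * v (hi_ix i) by rewrite mulrBl mul1r.
by rewrite -(opprB t 1) !mulNr divff // mulf_neq0.
Qed.

End Intertwiners.

Section Nodes.

Variable n : nat.
Implicit Types (i : 'I_n.-1) (lam mu nu : 'X_{1..n}) (p : {mpoly Kqt[n]}).

Lemma tilde_neq nu (a b : 'I_n) : a != b -> tilde nu a != tilde nu b.
Proof.
apply: contra; rewrite /tilde eqr_div ?expf_neq0 ?tK_neq0 // => /eqP/qt_monomial_inj[_].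
by move/kidx_inj->.
Qed.

Lemma tilde_aswap nu i : nu (lo_ix i) != nu (hi_ix i) ->
  tilde (aswap i nu) =1 tilde nu \o sadj i.
Proof. by move=> neq j; rewrite /tilde /= mswapE kidx_mswap ?hi_ixE. Qed.

Lemma tilde_flat nu i : nu (lo_ix i) = nu (hi_ix i) ->
  tK * tilde nu (lo_ix i) = tilde nu (hi_ix i).
Proof.
move=> flat; rewrite /tilde flat (kidx_flat (hi_ixE i) flat) exprS invfM.
by rewrite mulrCA mulVKf ?tK_neq0.
Qed.

Lemma meval_hecke_tilde p nu i : nu (lo_ix i) != nu (hi_ix i) ->
  (hecke_adj tK i p).@[tilde nu] = intertwiner_coef tK (tilde nu) i * p.@[tilde nu]
    + (tK * tilde nu (lo_ix i) - tilde nu (hi_ix i)) / (tilde nu (lo_ix i) - tilde nu (hi_ix i))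
      * p.@[tilde (aswap i nu)].
Proof.
move=> neq; rewrite meval_hecke_adj ?tilde_neq ?lo_hi_neq //.
by rewrite (meval_eq _ (tilde_aswap neq)).
Qed.

Lemma meval_hecke_tilde_flat p nu i : nu (lo_ix i) = nu (hi_ix i) ->
  (hecke_adj tK i p).@[tilde nu] = tK * p.@[tilde nu].
Proof. by move=> flat; rewrite meval_hecke_adj_flat ?tilde_neq ?lo_hi_neq ?tilde_flat. Qed.

Lemma tK_tilde_hi_neq_lo mu i : mu (lo_ix i) != mu (hi_ix i) ->
  tK * tilde mu (hi_ix i) != tilde mu (lo_ix i).
Proof.
apply: contra; rewrite /tilde mulrA eqr_div ?expf_neq0 ?tK_neq0 //.
rewrite mulrAC -exprS mulrC => /eqP/qt_monomial_inj[-> _].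
by [].
Qed.

Lemma tilde_first_zero nu (j : 'I_n) : nu j = 0%N ->
  (forall l : 'I_n, (l < j)%N -> (0 < nu l)%N) -> tilde nu j = tK ^- n.-1.
Proof. by move=> z pos; rewrite /tilde (kidx_first_zero z pos) z expr0 mul1r. Qed.

Lemma tilde_neq_tKV mu (j : 'I_n) e : (0 < mu j)%N -> tilde mu j != tK ^- e.
Proof.
move=> pos; rewrite /tilde -[tK ^- e]mul1r eqr_div ?expf_neq0 ?tK_neq0 // -(expr0 qK).
by apply: contraTneq pos => /qt_monomial_inj[-> _].
Qed.

Lemma tilde_unraise k nu j : (k <= n)%N -> front n k \subset supp nu ->
  tilde (unraise k nu) j = tilde nu (rotation n k j) / qK ^+ (rotation n k j \in front n k).
Proof.
move=> le_kn pos; rewrite /tilde kidx_unraise // !mnmE mulrAC; congr (_ / _).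
have /implyP := subsetP pos (rotation n k j); rewrite [in X in _ ==> X]inE.
case: (_ \in _) => /= [pos_j|_]; last by rewrite subn0 divr1.
by rewrite -[in RHS](subnK pos_j) exprD expr1 mulfK ?qK_neq0.
Qed.

Definition tilde1 mu (j : 'I_n) : Kt := tQ ^- kidx mu j.

Lemma spec1_tilde mu j : spec1 (tilde mu j) (tilde1 mu j).
Proof.
rewrite -[tilde1 mu j]mul1r -(expr1n _ (mu j)); apply: spec1M.
  exact/spec1X/spec1_q.
by apply: spec1V; [exact/spec1X/spec1_t|rewrite expf_neq0 ?tQ_neq0].
Qed.

Lemma tilde1_neq0 mu j : tilde1 mu j != 0.
Proof. by rewrite invr_eq0 expf_neq0 ?tQ_neq0. Qed.

Lemma tilde1_neq mu (a b : 'I_n) : a != b -> tilde1 mu a != tilde1 mu b.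
Proof. by apply: contra => /eqP/invr_inj/tQ_expI/kidx_inj->. Qed.

Lemma spec1_intertwiner_coef mu i :
  spec1 (intertwiner_coef tK (tilde mu) i) (intertwiner_coef tQ (tilde1 mu) i).
Proof.
apply: spec1M.
  by apply: spec1M (spec1_tilde _ _); apply: spec1B; [exact: spec1_1|exact: spec1_t].
apply: spec1V; first by apply: spec1B; exact: spec1_tilde.
by rewrite subr_eq0 tilde1_neq ?lo_hi_neq.
Qed.

End Nodes.

Section Interpolants.

Variable n : nat.
Implicit Types (i : 'I_n.-1) (lam mu nu : 'X_{1..n}) (p : {mpoly Kqt[n]}).

Definition vanishing mu p : Prop :=
  forall nu, (mdeg nu <= mdeg mu)%N -> nu != mu -> p.@[tilde nu] = 0.

(* Stronger than [IsEstar]: the other clauses are needed to carry the construction of [E*_mu] by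
   intertwining and raising through the induction, and to specialize it. *)
Definition interpolant mu p : Prop :=
  [/\ supp_dominated mu p, unitriangular mu p, vanishing mu p, p.@[tilde mu] != 0
    & exists g, mspec1 p g].

Definition intertwine mu i p : {mpoly Kqt[n]} :=
  hecke_adj tK i p - intertwiner_coef tK (tilde mu) i *: p.

Lemma vanishing_intertwine mu i p : mu (lo_ix i) != mu (hi_ix i) ->
  vanishing mu p -> vanishing (aswap i mu) (intertwine mu i p).
Proof.
move=> neq_mu van nu; rewrite mdeg_mswap => le_nu nu_neq; rewrite mevalB mevalZ.
have [flat|neq_nu] := eqVneq (nu (lo_ix i)) (nu (hi_ix i)).
  rewrite meval_hecke_tilde_flat // van ?mulr0 ?subr0 //.
  by apply: contra_eq_neq flat => ->.
rewrite meval_hecke_tilde // (van (aswap i nu)) ?mdeg_mswap //; last first.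
  by apply: contraNneq nu_neq => <-; rewrite aswapK.
rewrite mulr0 addr0; have [->|neq] := eqVneq nu mu; first by rewrite subrr.
by rewrite van // !mulr0 subrr.
Qed.

Lemma intertwine_node_neq0 mu i p : mu (lo_ix i) != mu (hi_ix i) ->
  vanishing mu p -> p.@[tilde mu] != 0 -> (intertwine mu i p).@[tilde (aswap i mu)] != 0.
Proof.
move=> neq_mu van nz.
have p_swap : p.@[tilde (aswap i mu)] = 0.
  by apply: van; [rewrite mdeg_mswap|exact: mswap_neq].
have neq_swap : aswap i mu (lo_ix i) != aswap i mu (hi_ix i) by rewrite mswapL mswapR eq_sym.
rewrite mevalB mevalZ (meval_hecke_tilde _ neq_swap) aswapK p_swap !mulr0 add0r subr0.
rewrite !(tilde_aswap neq_mu) /= tpermL tpermR.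
apply: mulf_neq0 nz; apply: mulf_neq0; first by rewrite subr_eq0 tK_tilde_hi_neq_lo.
by rewrite invr_eq0 subr_eq0 tilde_neq // eq_sym lo_hi_neq.
Qed.

Lemma interpolant_intertwine mu i p : descent i mu ->
  interpolant mu p -> interpolant (aswap i mu) (intertwine mu i p).
Proof.
move=> desc [dom tri van nz [g pg]].
have neq_mu := descent_neq desc.
split; [|exact: unitriangular_aswap|exact: vanishing_intertwine|exact: intertwine_node_neq0|].
  apply: (@supp_dominated_rearr _ _ mu); first by rewrite rearr_sym rearr_aswap rearr_refl.
  exact: supp_dominatedBZ (supp_dominated_hecke (lo_hi_neq i) dom) dom.
exists (hecke_adj tQ i g - intertwiner_coef tQ (tilde1 mu) i *: g).
apply: mspec1B; first exact: mspec1_hecke.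
exact: mspec1Z (spec1_intertwiner_coef _ _) _.
Qed.

Definition raise_qt k d p : {mpoly Kqt[n]} := raise k qK (tK ^- n.-1) d p.

Definition raise_t k (g : {mpoly Kt[n]}) : {mpoly Kt[n]} :=
  linprod (front n k) (fun=> tQ ^- n.-1) * msym (rotation n k) g.

Lemma meval_raise_qt k d nu p : (k <= n)%N -> front n k \subset supp nu ->
  (raise_qt k d p).@[tilde nu]
  = qK ^+ d * ((linprod (front n k) (fun=> tK ^- n.-1)).@[tilde nu]
               * p.@[tilde (unraise k nu)]).
Proof.
move=> le_kn pos; rewrite mevalZ mevalM meval_qscale meval_msym; congr (_ * (_ * _)).
by apply: meval_eq => j; rewrite /= tilde_unraise.
Qed.

Lemma vanishing_raise k lam d p : (k <= n)%N -> front n k \subset supp lam ->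
  vanishing (unraise k lam) p -> vanishing lam (raise_qt k d p).
Proof.
move=> le_kn lam_pos van nu le_nu nu_neq.
have [pos|/subsetPn[j0 j0_front j0_supp]] := boolP (front n k \subset supp nu).
  rewrite meval_raise_qt // van ?mulr0 //.
    by move: le_nu; rewrite (mdeg_unraise le_kn lam_pos) (mdeg_unraise le_kn pos) leq_add2r.
  by apply: contra nu_neq => /eqP/unraise_inj->.
have j0_zero : nu j0 == 0%N by move: j0_supp; rewrite inE lt0n negbK.
(* The first zero part of [nu] lies in the front, and there [tilde nu] equals [t^(1-n)]. *)
case: (@arg_minnP _ _ (fun j => nu j == 0%N) (fun j => j : nat) j0_zero) => j j_zero j_min.
have j_front : j \in front n k by move: j0_front; rewrite !inE; exact: leq_ltn_trans (j_min _ _).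
have node_j : tilde nu j = tK ^- n.-1.
  apply: tilde_first_zero (eqP j_zero) _ => l lt_l; rewrite lt0n.
  by apply: contraL lt_l => /j_min; rewrite leqNgt.
rewrite mevalZ mevalM /linprod (bigD1 j) //= mevalM mevalB mevalXU mevalC node_j.
by rewrite subrr !mul0r mulr0.
Qed.

Lemma raise_node_neq0 k lam d p : (k <= n)%N -> front n k \subset supp lam ->
  p.@[tilde (unraise k lam)] != 0 -> (raise_qt k d p).@[tilde lam] != 0.
Proof.
move=> le_kn pos nz; rewrite (meval_raise_qt _ _ le_kn pos).
apply: mulf_neq0; first by rewrite expf_neq0 ?qK_neq0.
apply: mulf_neq0 nz; rewrite rmorph_prod; apply/prodf_neq0 => j /(subsetP pos).
rewrite inE => pos_j /=.
by rewrite mevalB mevalXU mevalC subr_eq0 tilde_neq_tKV.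
Qed.

Lemma mspec1_raise k d p g : mspec1 p g -> mspec1 (raise_qt k d p) (raise_t k g).
Proof.
have spec1_qX e : spec1 (qK ^+ e) 1 by rewrite -(expr1n _ e); exact/spec1X/spec1_q.
move=> pg; rewrite -[raise_t k g]scale1r; apply: mspec1Z => //; apply: mspec1M.
  apply: mspec1_linprod => _; apply: spec1V; first exact/spec1X/spec1_t.
  by rewrite expf_neq0 ?tQ_neq0.
move=> m; rewrite mcoeff_qscale -[(msym _ g)@_m]divr1; apply: spec1M.
  exact: mspec1_msym.
by apply: spec1V; rewrite ?oner_eq0.
Qed.

Lemma interpolant_raise k lam p : (k <= n)%N -> supp lam = front n k ->
  interpolant (unraise k lam) p ->
  interpolant lam (raise_qt k (mdeg (strip_column lam)) p).
Proof.
move=> le_kn lam_supp [dom tri van nz [g pg]].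
have pos : front n k \subset supp lam by rewrite lam_supp.
split.
- exact: supp_dominated_raise.
- exact: (@unitriangular_raise Kqt _ _ _ _ le_kn qK_neq0 _ _ lam_supp dom tri).
- exact: vanishing_raise.
- exact: raise_node_neq0.
- by exists (raise_t k g); exact: mspec1_raise.
Qed.

Lemma interpolant0 : interpolant 0%MM 1.
Proof.
split.
- by move=> m; rewrite mcoeff1; have [->|] := eqVneq m 0%MM; rewrite ?eqxx // => _ c.
- split; first by rewrite mcoeff1 eqxx.
  by move=> nu _ _ /negPf nu_neq; rewrite mcoeff1 nu_neq.
- by move=> nu; rewrite mdeg0 leqn0 mdeg_eq0 => ->.
- by rewrite meval1 oner_eq0.
- by exists 1; exact: mspec1_1.
Qed.

Lemma interpolant_exists mu : exists p, interpolant mu p.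
Proof.
have [N] := ubnP (mdeg mu); elim: N mu => // N IHN; elim/partition_aswap_ind.
  move=> lam part lt_N; have lam_supp := supp_partition part.
  have [lam1_0|lam1_gt0] := posnP (conjp lam 1).
    suff -> : lam = 0%MM by exists 1; exact: interpolant0.
    apply/mnmP=> j; rewrite mnm0E; have /setP/(_ j) := lam_supp.
    by rewrite lam1_0 !inE; case: (lam j).
  have [|p p_int] := IHN (unraise (conjp lam 1) lam).
    move: lt_N; rewrite (@mdeg_unraise _ (conjp lam 1)) ?conjp_le ?lam_supp // ltnS.
    by apply: leq_trans; rewrite -[ltnLHS]addn0 ltn_add2l.
  by eexists; exact: interpolant_raise (conjp_le lam 1) lam_supp p_int.
move=> mu i desc IHmu; rewrite mdeg_mswap => /IHmu[p p_int].
by exists (intertwine mu i p); exact: interpolant_intertwine.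
Qed.

Definition an_interpolant mu : {mpoly Kqt[n]} := epsilon (inhabits 0) (interpolant mu).

Lemma an_interpolantP mu : interpolant mu (an_interpolant mu).
Proof. exact: epsilon_spec (interpolant_exists mu). Qed.

Lemma tilde_interpolation_eq0 d (f : {mpoly Kqt[n]}) : (msize f <= d)%N ->
  (forall nu, (mdeg nu < d)%N -> f.@[tilde nu] = 0) -> f = 0.
Proof.
apply: (@interpolation_eq0 _ _ _ an_interpolant) => [mu|mu|mu];
  have [dom _ van nz _] := an_interpolantP mu => //.
exact: supp_dominated_msize.
Qed.

Lemma tilde_interpolation_uniq d m (u : 'X_{1..n} -> Kqt) (cf cg : Kqt)
    (f g : {mpoly Kqt[n]}) :
  (msize f <= d)%N -> (msize g <= d)%N -> f@_m = 1 -> g@_m = 1 ->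
  (forall nu, (mdeg nu < d)%N -> f.@[tilde nu] = cf * u nu) ->
  (forall nu, (mdeg nu < d)%N -> g.@[tilde nu] = cg * u nu) -> f = g.
Proof.
apply: (@interpolation_uniq _ _ _ an_interpolant) => [mu|mu|mu];
  have [dom _ van nz _] := an_interpolantP mu => //.
exact: supp_dominated_msize.
Qed.

Lemma interpolant_IsEstar mu p : interpolant mu p -> IsEstar mu p.
Proof. by case=> dom [p_mu _] van _ _; split=> //; exact: supp_dominated_msize. Qed.

Lemma IsEstar_node mu p nu : IsEstar mu p -> (mdeg nu <= mdeg mu)%N ->
  p.@[tilde nu] = p.@[tilde mu] * (nu == mu)%:R.
Proof.
move=> [_ _ van] le_nu; have [->|nu_neq] := eqVneq nu mu; first by rewrite mulr1.
by rewrite van // mulr0.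
Qed.

Lemma IsEstar_uniq mu p p' : IsEstar mu p -> IsEstar mu p' -> p = p'.
Proof.
move=> pE p'E; have [p_size p_mu _] := pE; have [p'_size p'_mu _] := p'E.
have p_node nu := @IsEstar_node mu p nu pE.
have p'_node nu := @IsEstar_node mu p' nu p'E.
exact: tilde_interpolation_uniq p_size p'_size p_mu p'_mu p_node p'_node.
Qed.

Lemma EstarE mu p : IsEstar mu p -> Estar mu = p.
Proof.
move=> pE; apply: (IsEstar_uniq (mu := mu)) => //.
by apply: (epsilon_spec (inhabits 0) (IsEstar mu)); exists p.
Qed.

Lemma Estar_interpolant mu : interpolant mu (Estar mu).
Proof.
have int_mu := an_interpolantP mu.
by rewrite (EstarE (interpolant_IsEstar int_mu)).
Qed.

Lemma hecke_adj_Estar_desc mu i : descent i mu ->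
  hecke_adj tK i (Estar mu)
  = Estar (aswap i mu) + intertwiner_coef tK (tilde mu) i *: Estar mu.
Proof.
move=> desc; have := interpolant_intertwine desc (Estar_interpolant mu).
by move/interpolant_IsEstar/EstarE=> ->; rewrite subrK.
Qed.

Lemma hecke_adj_Estar_flat mu i : mu (lo_ix i) = mu (hi_ix i) ->
  hecke_adj tK i (Estar mu) = tK *: Estar mu.
Proof.
move=> flat; have [dom _ van _ _] := Estar_interpolant mu; apply: subr0_eq.
apply: (@tilde_interpolation_eq0 (mdeg mu).+1) => [|nu le_nu].
  exact/supp_dominated_msize/supp_dominatedBZ/dom/supp_dominated_hecke/dom/lo_hi_neq.
rewrite mevalB mevalZ; have [flat_nu|neq_nu] := eqVneq (nu (lo_ix i)) (nu (hi_ix i)).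
  by rewrite meval_hecke_tilde_flat // subrr.
have nu_neq : nu != mu by apply: contraNneq neq_nu => ->; rewrite flat.
have swap_neq : aswap i nu != mu.
  apply: contraNneq neq_nu => swapE.
  by rewrite -[nu](aswapK i) swapE /aswap mswapL mswapR flat.
by rewrite meval_hecke_tilde // (van _ le_nu nu_neq) van ?mdeg_mswap // !mulr0 addr0 subrr.
Qed.

Lemma Estar_family : hecke_family tK (@Estar n).
Proof.
split=> [mu|mu|mu i desc|mu i]; last exact: hecke_adj_Estar_flat.
- by have [] := Estar_interpolant mu.
- by have [] := Estar_interpolant mu.
- by eexists; exact: hecke_adj_Estar_desc.
Qed.

Lemma Estar_raise k lam : (k <= n)%N -> supp lam = front n k ->
  Estar lam = raise_qt k (mdeg (strip_column lam)) (Estar (unraise k lam)).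
Proof.
move=> le_kn lam_supp; apply/EstarE/interpolant_IsEstar/interpolant_raise => //.
exact: Estar_interpolant.
Qed.

Lemma Estar0 : Estar (0%MM : 'X_{1..n}) = 1.
Proof. exact/EstarE/interpolant_IsEstar/interpolant0. Qed.

End Interpolants.

(** * Interpolation polynomials at q = 1 *)

Section InterpolationAtOne.

Variable n : nat.
Implicit Types (i : 'I_n.-1) (lam mu nu : 'X_{1..n}) (f : {mpoly Kqt[n]}) (g : {mpoly Kt[n]}).

Lemma mspec1_supp_dominated mu f g : mspec1 f g -> supp_dominated mu f -> supp_dominated mu g.
Proof.
move=> fg dom m g_m; apply: dom; apply: contraNneq g_m => f_m; apply/eqP.
by apply: spec1_uniq (fg m) _; rewrite f_m; exact: spec1_0.
Qed.

Lemma mspec1_unitriangular mu f g : mspec1 f g -> unitriangular mu f -> unitriangular mu g.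
Proof.
move=> fg [f_mu f_nu]; split=> [|nu nu_mu le_nu nu_neq].
  by apply: spec1_uniq (fg mu) _; rewrite f_mu; exact: spec1_1.
by apply: spec1_uniq (fg nu) _; rewrite f_nu //; exact: spec1_0.
Qed.

Definition Estar1 mu : {mpoly Kt[n]} := epsilon (inhabits 0) (mspec1 (Estar mu)).

Lemma mspec1_Estar mu : mspec1 (Estar mu) (Estar1 mu).
Proof. by have [_ _ _ _] := Estar_interpolant mu; exact: epsilon_spec. Qed.

Lemma Estar1E mu g : mspec1 (Estar mu) g -> Estar1 mu = g.
Proof. exact/mspec1_uniq/mspec1_Estar. Qed.

Lemma hecke_adj_Estar1_desc mu i : descent i mu ->
  hecke_adj tQ i (Estar1 mu)
  = Estar1 (aswap i mu) + intertwiner_coef tQ (tilde1 mu) i *: Estar1 mu.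
Proof.
move=> desc; have := mspec1_hecke (lo_ix i) (hi_ix i) (mspec1_Estar mu).
rewrite -[hecke tK _ _ _]/(hecke_adj tK i _) hecke_adj_Estar_desc // => spec.
apply: mspec1_uniq spec _; apply: mspec1D; first exact: mspec1_Estar.
exact: mspec1Z (spec1_intertwiner_coef _ _) (mspec1_Estar _).
Qed.

Lemma hecke_adj_Estar1_flat mu i : mu (lo_ix i) = mu (hi_ix i) ->
  hecke_adj tQ i (Estar1 mu) = tQ *: Estar1 mu.
Proof.
move=> flat; have := mspec1_hecke (lo_ix i) (hi_ix i) (mspec1_Estar mu).
rewrite -[hecke tK _ _ _]/(hecke_adj tK i _) hecke_adj_Estar_flat // => spec.
by apply: mspec1_uniq spec _; apply: mspec1Z spec1_t (mspec1_Estar mu).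
Qed.

Lemma Estar1_family : hecke_family tQ Estar1.
Proof.
have [E_dom E_tri _ _] := Estar_family n.
split=> [mu|mu|mu i desc|mu i]; last exact: hecke_adj_Estar1_flat.
- exact: mspec1_supp_dominated (mspec1_Estar mu) (E_dom mu).
- exact: mspec1_unitriangular (mspec1_Estar mu) (E_tri mu).
- by eexists; exact: hecke_adj_Estar1_desc.
Qed.

Lemma Estar1_raise k lam : (k <= n)%N -> supp lam = front n k ->
  Estar1 lam = raise_t k (Estar1 (unraise k lam)).
Proof.
move=> le_kn lam_supp; apply: Estar1E; rewrite (Estar_raise le_kn lam_supp).
exact/mspec1_raise/mspec1_Estar.
Qed.

Lemma Estar1_0 : Estar1 0%MM = 1.
Proof. by apply: Estar1E; rewrite Estar0; exact: mspec1_1. Qed.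

Definition increasing mu : Prop := forall j l : 'I_n, (j <= l)%N -> (mu j <= mu l)%N.

Lemma outranks_increasing mu j l : increasing mu -> outranks mu l j = (j < l)%N.
Proof.
rewrite /outranks => inc; case: (ltngtP j l) => [lt_jl|lt_lj|/ord_inj->].
- by have := inc j l (ltnW lt_jl); lia.
- by have := inc l j (ltnW lt_lj); lia.
- by rewrite ltnn andbF.
Qed.

Lemma kidx_increasing mu i : increasing mu -> kidx mu (lo_ix i) = (kidx mu (hi_ix i)).+1.
Proof.
move=> inc; apply: kidx_succ => [l l_hi|]; rewrite !outranks_increasing ?hi_ixE //.
have {l_hi} : (l : nat) != hi_ix i by [].
by rewrite hi_ixE; lia.
Qed.

(* At [q = 1] the intertwining relation at an ascent of an increasing composition, where the
   intertwiner coefficient is [-1], degenerates to an eigenvector equation. *)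
Lemma hecke_adj_Estar1_increasing mu i : increasing mu ->
  hecke_adj tQ i (Estar1 mu) = tQ *: Estar1 mu.
Proof.
move=> inc; have := inc (lo_ix i) (hi_ix i); rewrite hi_ixE leqnSn => /(_ isT).
rewrite leq_eqVlt => /orP[/eqP/hecke_adj_Estar1_flat//|asc].
have tilde1_lo : tilde1 (aswap i mu) (lo_ix i) = tQ * tilde1 (aswap i mu) (hi_ix i).
  rewrite /tilde1 !kidx_mswap ?hi_ixE ?ltn_eqF // tpermL tpermR (kidx_increasing i inc).
  by rewrite exprS invfM mulVKf ?tQ_neq0.
have /hecke_adj_Estar1_desc/hecke_adj_ascent : descent i (aswap i mu) by rewrite descent_aswap.
rewrite aswapK (intertwiner_coef_eqN1 tQ_neq1 (tilde1_neq0 _ _) tilde1_lo) => ->.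
by rewrite opprK subrK mulN1r subrr scale0r addr0.
Qed.

Lemma Estar1_increasing_sym mu : increasing mu -> Estar1 mu \is symmetric.
Proof.
move=> inc; apply: symmetric_sadj => i.
exact: hecke_eigen_sym (lo_hi_neq i) tQ_neq0 (hecke_adj_Estar1_increasing i inc).
Qed.

Definition rev_perm : 'S_n := perm (@rev_ord_inj n).

Definition mrev lam : 'X_{1..n} := lam # rev_perm.

Lemma rearr_mrev lam : rearr (mrev lam) lam.
Proof. exact: rearr_mperm. Qed.

Lemma mrev_increasing lam : is_partition lam -> increasing (mrev lam).
Proof. by move/partitionP=> dec j l le_jl; rewrite !mnmE !permE; apply: dec => /=; lia. Qed.

(* Being symmetric, the value at [q = 1] of [E*] at the increasing rearrangement of [lam] turns
   out to be that of [P*_lam]. *)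
Definition Pstar1 lam : {mpoly Kt[n]} := Estar1 (mrev lam).

Lemma Pstar1_sym lam : is_partition lam -> Pstar1 lam \is symmetric.
Proof. by move=> part; exact/Estar1_increasing_sym/mrev_increasing. Qed.

Lemma Pstar1_mdeg lam m : (Pstar1 lam)@_m != 0 -> (mdeg m <= mdeg lam)%N.
Proof.
have [E_dom _ _ _] := Estar1_family.
by move=> /E_dom/dominates_mdeg; rewrite (mdeg_rearr (rearr_mrev lam)).
Qed.

Lemma mcoeff_Pstar1 lam nu : is_partition lam -> rearr nu lam -> (Pstar1 lam)@_nu = 1.
Proof.
move=> part nu_lam; have [_ E_tri _ _] := Estar1_family.
have /rearrP[s ->] : rearr nu (mrev lam).
  by apply: rearr_trans nu_lam _; rewrite rearr_sym rearr_mrev.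
rewrite msym_coeff; last exact: Pstar1_sym.
by have [] := E_tri (mrev lam).
Qed.

Lemma Pstar1_0 : Pstar1 0%MM = 1.
Proof.
by rewrite /Pstar1 (_ : mrev 0%MM = 0%MM) ?Estar1_0 //; apply/mnmP=> j; rewrite !mnmE.
Qed.

End InterpolationAtOne.

(** * Subsets of given cardinality and their linear factors *)

Section Slides.

Variable n : nat.
Implicit Types (i : 'I_n.-1) (j l : 'I_n) (S T : {set 'I_n}) (lam mu nu : 'X_{1..n}).

Definition slide i S : {set 'I_n} := hi_ix i |: S :\ lo_ix i.

Lemma slide_preim_tperm i S :
  lo_ix i \notin S -> hi_ix i \in S -> slide i (sadj i @^-1: S) = S.
Proof.
move=> loS hiS; apply/setP=> j; rewrite !inE.
have [->|j_hi] := eqVneq j (hi_ix i); first by rewrite hiS.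
have [->|j_lo] /= := eqVneq j (lo_ix i); first by rewrite (negPf loS).
by rewrite tpermD // eq_sym.
Qed.

Lemma slide_ind k (P : {set 'I_n} -> Prop) :
  P (front n k) ->
  (forall i S, lo_ix i \in S -> hi_ix i \notin S -> P S -> P (slide i S)) ->
  forall S, #|S| = k -> P S.
Proof.
move=> P_front P_slide S cardS.
suff P_mesym1 mu : forall T, #|T| = k -> mesym1 T = mu -> P T by exact: P_mesym1 erefl.
elim/partition_aswap_ind: mu {S cardS} => [mu part T cardT muE|mu i desc IHmu T cardT muE].
  have := supp_partition part; rewrite -muE supp_mesym1 => ->.
  by rewrite conjp1 supp_mesym1 cardT.
have mesym1_preim : mesym1 (sadj i @^-1: T) = mu.
  by rewrite -(aswapK i mu) -muE; apply/mnmP=> j; rewrite !mnmE inE.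
move: desc; rewrite -mesym1_preim /descent !mnmE !inE tpermL tpermR.
case: (boolP (lo_ix i \in T)) (boolP (hi_ix i \in T)) => [loT|loT] [hiT|hiT] // _.
rewrite -(slide_preim_tperm loT hiT); apply: P_slide; rewrite ?inE ?tpermL ?tpermR //.
by apply: IHmu mesym1_preim; rewrite card_preimset //; exact: perm_inj.
Qed.

Definition Sroot S j : Kt := tQ ^+ #|[set l in ~: S | (l < j)%N]| / tQ ^+ n.-1.

Lemma SfactorE S : Sfactor S = linprod S (Sroot S).
Proof. by []. Qed.

Lemma Sroot_front k j : j \in front n k -> Sroot (front n k) j = tQ ^- n.-1.
Proof.
rewrite inE => lt_jk; rewrite /Sroot (_ : [set l in _ | _] = set0) ?cards0 ?mul1r //.
by apply/setP=> l; rewrite !inE; lia.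
Qed.

Lemma Sroot_slide_hi i S :
  Sroot (slide i S) (hi_ix i) = tQ * Sroot S (lo_ix i).
Proof.
rewrite /Sroot mulrA -exprS; congr (_ ^+ _ / _).
have -> : [set l in ~: slide i S | (l < hi_ix i)%N]
    = lo_ix i |: [set l in ~: S | (l < lo_ix i)%N].
  apply/setP=> l; rewrite !inE hi_ixE ltnS.
  have [->|l_lo] := eqVneq l (lo_ix i); first by rewrite (negPf (lo_hi_neq i)) leqnn.
  have [->|l_hi] := eqVneq l (hi_ix i); first by rewrite /= hi_ixE ltnNge leqnSn andbF.
  by rewrite leq_eqVlt val_eqE (negPf l_lo).
by rewrite cardsU1 !inE ltnn andbF.
Qed.

Lemma Sroot_slide i S j : lo_ix i \in S -> hi_ix i \notin S ->
  j != lo_ix i -> j != hi_ix i -> Sroot (slide i S) j = Sroot S j.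
Proof.
move=> loS hiS j_lo j_hi; congr (_ ^+ _ / _).
have lt_lo : (lo_ix i < j)%N = (hi_ix i < j)%N.
  by rewrite [RHS]ltn_neqAle -[X in ~~ X]/(hi_ix i == j) eq_sym j_hi hi_ixE.
rewrite -[LHS](card_preimset _ (@perm_inj _ (sadj i))); apply: eq_card => l; rewrite !inE.
case: tpermP => [->|->|/eqP l_lo /eqP l_hi].
- by rewrite eqxx loS.
- by rewrite (negPf (lo_hi_neq i)) eqxx hiS /= lt_lo.
- by rewrite (negPf l_lo) (negPf l_hi).
Qed.

Lemma hecke_adj_Sfactor i S (A : {mpoly Kt[n]}) : lo_ix i \in S -> hi_ix i \notin S ->
  A \is symmetric -> hecke_adj tQ i (Sfactor S * A) = Sfactor (slide i S) * A.
Proof.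
move=> loS hiS /issymP A_sym; pose Q := linprod (S :\ lo_ix i) (Sroot S).
have off_lo_hi j : j \in S :\ lo_ix i -> j != lo_ix i /\ j != hi_ix i.
  by rewrite !inE => /andP[j_lo jS]; split=> //; apply: contraNneq hiS => <-.
have SE : Sfactor S = ('X_(lo_ix i) - (Sroot S (lo_ix i))%:MP) * Q.
  by rewrite SfactorE /linprod (big_setD1 _ loS).
have slideE : Sfactor (slide i S) = ('X_(hi_ix i) - (tQ * Sroot S (lo_ix i))%:MP) * Q.
  rewrite SfactorE /linprod big_setU1 /= ?Sroot_slide_hi //; last first.
    by rewrite !inE (negPf hiS) andbF.
  congr (_ * _); apply: eq_bigr => j /off_lo_hi[j_lo j_hi].
  by rewrite Sroot_slide.
have Q_sym : msym (sadj i) Q = Q.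
  rewrite /Q /linprod rmorph_prod; apply: eq_bigr => j /off_lo_hi[j_lo j_hi] /=.
  by rewrite msymB msymXU msymC tpermD // eq_sym.
rewrite SE slideE -!mulrA; apply: hecke_linear_factor (lo_hi_neq i) _.
by rewrite msymM Q_sym A_sym.
Qed.

End Slides.

(** * Factorization at q = 1 *)

Section Factorization.

Variable n : nat.
Implicit Types (i : 'I_n.-1) (S : {set 'I_n}) (lam mu nu : 'X_{1..n}).

(* Raising [E*] at the increasing rearrangement of [strip_column lam] gives [E*] at the composition
   [kap] whose positive parts fill the front in increasing order. *)
Lemma Sfactor_front_span lam : is_partition lam ->
  orbit_span (@Estar1 n) lam (Sfactor (front n (conjp lam 1)) * Pstar1 (strip_column lam)).
Proof.
move=> part; have le_kn := conjp_le lam 1; have lam_supp := supp_partition part.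
set k := conjp lam 1 in le_kn lam_supp *; pose rot := rotation n k.
pose kap : 'X_{1..n} := lam # (rot^-1 * rev_perm n)%g.
have kap_lam : rearr kap lam by exact: rearr_mperm.
have kap_supp : supp kap = front n k.
  apply/setP=> j; rewrite -[in RHS](permKV rot j) rotation_front // inE mnmE permM permE.
  have /setP/(_ (rev_ord (rot^-1 j)%g)) := lam_supp; rewrite !inE => -> /=.
  by have := ltn_ord (rot^-1 j)%g; lia.
have kap_unraise : unraise k kap = mrev (strip_column lam).
  rewrite unraise_strip_column //; apply/mnmP=> j.
  by rewrite !mnmE permM permK.
suff <- : Estar1 kap = Sfactor (front n k) * Pstar1 (strip_column lam).
  exact: orbit_span_mem.
rewrite (Estar1_raise le_kn kap_supp) kap_unraise /raise_t.
have /issymP-> := Pstar1_sym (strip_column_partition part).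
rewrite SfactorE; congr (_ * _); apply: eq_bigr => j j_front.
by rewrite Sroot_front.
Qed.

Lemma Sfactor_span lam S : is_partition lam -> #|S| = conjp lam 1 ->
  orbit_span (@Estar1 n) lam (Sfactor S * Pstar1 (strip_column lam)).
Proof.
move=> part; move: S; apply: slide_ind => [|i S loS hiS span].
  exact: Sfactor_front_span.
have A_sym := Pstar1_sym (strip_column_partition part).
rewrite -(hecke_adj_Sfactor loS hiS A_sym).
exact: (orbit_span_hecke (Estar1_family n)).
Qed.

Lemma Sfactor_indicator lam S : is_partition lam -> #|S| = conjp lam 1 ->
  orbit_indicator (@Estar1 n) lam (fun nu => supp nu == S)
    (Sfactor S * Pstar1 (strip_column lam)).
Proof.
move=> part cardS; split=> [|nu nu_lam]; first exact: Sfactor_span.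
rewrite SfactorE (mcoeff_linprodM_column _ cardS nu_lam) => [|m]; last exact: Pstar1_mdeg.
case: eqP => // _; apply: mcoeff_Pstar1; first exact: strip_column_partition.
exact: rearr_strip_column.
Qed.

Lemma Pstar1_indicator lam : is_partition lam ->
  orbit_indicator (@Estar1 n) lam xpredT (Pstar1 lam).
Proof.
move=> part; split=> [|nu nu_lam]; first exact/orbit_span_mem/rearr_mrev.
exact: mcoeff_Pstar1.
Qed.

Lemma Pstar1_rec lam : is_partition lam ->
  Pstar1 lam = estar n (conjp lam 1) * Pstar1 (strip_column lam).
Proof.
move=> part; apply: (orbit_indicator_uniq (Estar1_family n) (Pstar1_indicator part)).
pose card_eq S := #|S| == conjp lam 1.
apply: (@orbit_indicator_ext _ _ _ _ (card_eq \o @supp n)).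
  by move=> nu nu_lam; rewrite /= /card_eq -conjp1 (conjp_rearr 1 nu_lam) eqxx.
rewrite /estar mulr_suml; apply: orbit_indicator_sum => S /eqP.
exact: Sfactor_indicator.
Qed.

Lemma Pstar1_prod lam : is_partition lam ->
  Pstar1 lam = \prod_(1 <= c < (part1 lam).+1) estar n (conjp lam c).
Proof.
move eqd : (part1 lam) => d; elim: d lam eqd => [|d IHd] lam eqd part.
  by rewrite (part1_eq0 part eqd) Pstar1_0 big_geq.
have strip_part1 : part1 (strip_column lam) = d by rewrite part1_strip_column eqd.
rewrite (Pstar1_rec part) (IHd _ strip_part1 (strip_column_partition part)) -{1}strip_part1.
by rewrite (prod_conjp_strip_column lam (estar n)) eqd [RHS]big_ltn.
Qed.

End Factorization.

(** * The polynomials f*_mu and P*_lam *)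

Section SymmetricInterpolation.

Variable n : nat.
Implicit Types (i : 'I_n.-1) (S : {set 'I_n}) (lam mu nu : 'X_{1..n}) (P : pred 'X_{1..n}).

Lemma fstarE lam mu : fstar lam mu = hecke_word tK (sigma_word lam mu) (Estar lam).
Proof.
rewrite /fstar /Tperm /hecke_word /sigma_word; elim: (red_word _) => //= i w ->.
exact: HeckeE.
Qed.

Lemma mspec1_fstar lam mu :
  mspec1 (fstar lam mu) (hecke_word tQ (sigma_word lam mu) (Estar1 lam)).
Proof.
rewrite fstarE /hecke_word; elim: (sigma_word lam mu) => [|i w IHw] /=.
  exact: mspec1_Estar.
exact: mspec1_hecke IHw.
Qed.

Definition fstar_sum lam P : {mpoly Kqt[n]} :=
  \sum_(mu : 'X_{1..n < (mdeg lam).+1} | rearr mu lam && P mu) fstar lam mu.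

Lemma fstar_sum_indicator lam P : is_partition lam ->
  orbit_indicator (@Estar n) lam P (fstar_sum lam P).
Proof.
move=> part; rewrite /fstar_sum; under eq_bigr do rewrite fstarE.
have words_red := @sigma_word_reduced _ lam ^~ part.
exact: (sum_hecke_word_indicator (Estar_family n) P part words_red).
Qed.

Lemma mspec1_fstar_sum lam P (g : {mpoly Kt[n]}) : is_partition lam ->
  orbit_indicator (@Estar1 n) lam P g -> mspec1 (fstar_sum lam P) g.
Proof.
move=> part g_ind; have words_red := @sigma_word_reduced _ lam ^~ part.
have word_ind := sum_hecke_word_indicator (Estar1_family n) P part words_red.
rewrite -(orbit_indicator_uniq (Estar1_family n) word_ind g_ind).
by apply: mspec1_sum => mu _; exact: mspec1_fstar.
Qed.

Lemma mspec1_fstar_sum_supp lam S : is_partition lam -> #|S| = plen lam ->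
  mspec1 (fstar_sum lam (fun mu => supp mu == S))
    (Sfactor S * \prod_(2 <= c < (part1 lam).+1) estar n (conjp lam c)).
Proof.
move=> part cardS; rewrite -(prod_conjp_strip_column lam (estar n)).
rewrite -Pstar1_prod ?strip_column_partition //.
exact/mspec1_fstar_sum/Sfactor_indicator.
Qed.

Lemma orbit_span_vanish lam f nu : orbit_span (@Estar n) lam f ->
  (mdeg nu <= mdeg lam)%N -> ~~ rearr nu lam -> f.@[tilde nu] = 0.
Proof.
case=> c -> le_nu nu_lam; rewrite raddf_sum /= big1 // => mu mu_lam; rewrite mevalZ.
have [_ _ van _ _] := Estar_interpolant mu; rewrite van ?mulr0 //.
  by rewrite (mdeg_rearr mu_lam).
by apply: contraNneq nu_lam => ->.
Qed.

(* The sum of all [f*_mu] has equal coefficients on the rearrangements of [lam], hence so has its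
   image by [T_i] up to the factor [t]: it is an eigenvector of every [T_i], i.e. symmetric. *)
Lemma fstar_sum_sym lam : is_partition lam -> fstar_sum lam xpredT \is symmetric.
Proof.
move=> part; have [span coef] := fstar_sum_indicator xpredT part.
apply: symmetric_sadj => i; apply: hecke_eigen_sym (lo_hi_neq i) tK_neq0 _.
apply: (orbit_span_eq (Estar_family n) (lam := lam)).
- exact: orbit_span_hecke (Estar_family n) _ _ _ span.
- exact: orbit_spanZ.
have dom := orbit_span_dominated (Estar_family n) span.
move=> nu nu_lam; rewrite (mcoeff_hecke_rearr _ (lo_hi_neq i) dom nu_lam) mcoeffZ.
by rewrite !coef ?rearr_mswapl // !mulr1 hecke_stayDswap.
Qed.

Lemma fstar_sum_IsPstar lam : is_partition lam -> IsPstar lam (fstar_sum lam xpredT).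
Proof.
move=> part; have [span coef] := fstar_sum_indicator xpredT part; split.
- exact: fstar_sum_sym.
- exact/supp_dominated_msize/(orbit_span_dominated (Estar_family n)).
- by rewrite coef // rearr_refl.
move=> nu nu_part le_nu nu_neq; apply: (orbit_span_vanish span le_nu).
by apply: contra nu_neq => /(rearr_partition nu_part part)->.
Qed.

Lemma symmetric_node_sorted nu : exists2 lam, is_partition lam & rearr nu lam /\
  forall p : {mpoly Kqt[n]}, p \is symmetric -> p.@[tilde nu] = p.@[tilde lam].
Proof.
elim/partition_aswap_ind: nu => [lam part|nu i desc [lam part [nu_lam sym_val]]].
  by exists lam => //; split=> //; exact: rearr_refl.
exists lam => //; split=> [|p p_sym]; first by rewrite rearr_aswap.
rewrite -(sym_val p p_sym).
rewrite (meval_eq p (tilde_aswap (descent_neq desc))) -meval_msym.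
by move/issymP: p_sym => ->.
Qed.

Lemma IsPstar_node lam p nu : is_partition lam -> IsPstar lam p ->
  (mdeg nu <= mdeg lam)%N -> p.@[tilde nu] = p.@[tilde lam] * (rearr nu lam)%:R.
Proof.
move=> part [p_sym _ _ van] le_nu; have [kap kap_part [nu_kap ->//]] := symmetric_node_sorted nu.
have [kapE|kap_neq] := eqVneq kap lam; first by rewrite -kapE nu_kap mulr1.
rewrite (van kap kap_part _ kap_neq) -?(mdeg_rearr nu_kap) //.
have /negPf-> : ~~ rearr nu lam; last by rewrite mulr0.
apply: contra kap_neq => nu_lam; apply/eqP/rearr_partition => //.
by apply: rearr_trans nu_lam; rewrite rearr_sym.
Qed.

Lemma IsPstar_uniq lam p p' : is_partition lam -> IsPstar lam p -> IsPstar lam p' -> p = p'.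
Proof.
move=> part pP p'P; have [_ p_size p_lam _] := pP; have [_ p'_size p'_lam _] := p'P.
have p_node nu := @IsPstar_node lam p nu part pP.
have p'_node nu := @IsPstar_node lam p' nu part p'P.
exact: tilde_interpolation_uniq p_size p'_size p_lam p'_lam p_node p'_node.
Qed.

Lemma PstarE lam p : is_partition lam -> IsPstar lam p -> Pstar lam = p.
Proof.
move=> part pE; apply: (IsPstar_uniq part) => //.
by apply: (epsilon_spec (inhabits 0) (IsPstar lam)); exists p.
Qed.

Lemma mspec1_Pstar lam : is_partition lam -> mspec1 (Pstar lam) (Pstar1 lam).
Proof.
move=> part; rewrite (PstarE part (fstar_sum_IsPstar part)).
exact/mspec1_fstar_sum/Pstar1_indicator.
Qed.

Lemma mspec1_Pstar_ones k : (k <= n)%N -> mspec1 (Pstar (ones n k)) (estar n k).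
Proof.
move=> le_kn; have ones_part : is_partition (ones n k).
  apply/partitionP=> j l le_jl; rewrite !mnmE.
  by case: (ltnP l k) => // /(leq_ltn_trans le_jl)->.
have := mspec1_Pstar ones_part; rewrite (Pstar1_rec ones_part).
have -> : strip_column (ones n k) = 0%MM by apply/mnmP=> j; rewrite !mnmE; case: ltnP.
have -> : conjp (ones n k) 1 = k.
  by rewrite -[RHS](card_front le_kn); apply: eq_card => j; rewrite !inE mnmE lt0b.
by rewrite Pstar1_0 mulr1.
Qed.

End SymmetricInterpolation.

Theorem theorem7p1 (n : nat) :
  (forall lam : 'X_{1..n}, is_partition lam -> (0 < part1 lam)%N ->
   forall S : {set 'I_n}, #|S| = plen lam ->
     mspec1
       (\sum_(mu : 'X_{1..n < (mdeg lam).+1} |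
                perm_eq (val (val (val mu))) (val (val lam)) && (supp mu == S))
           fstar lam mu)
       (Sfactor S * \prod_(2 <= i < (part1 lam).+1) estar n (conjp lam i)))
  /\
  (forall lam : 'X_{1..n}, is_partition lam ->
   exists g : nat -> {mpoly Kt[n]},
     [/\ forall i, (1 <= i <= part1 lam)%N ->
                   mspec1 (Pstar (ones n (conjp lam i))) (g i),
         mspec1 (Pstar lam) (\prod_(1 <= i < (part1 lam).+1) g i) &
         \prod_(1 <= i < (part1 lam).+1) g i
           = \prod_(1 <= i < (part1 lam).+1) estar n (conjp lam i)]).
Proof.
split=> [lam part _ S cardS|lam part]; first exact: mspec1_fstar_sum_supp.
exists (fun c => estar n (conjp lam c)); split=> // [c _|].
  exact/mspec1_Pstar_ones/conjp_le.
by rewrite -Pstar1_prod //; exact: mspec1_Pstar.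
Qed.
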